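(* Let $f\in C^d(\overline S)$ and let $\varphi\in L^\infty(S)$ be centered on $[d]$. Define $$(U_{[d]}\varphi)(\omega)=\int_{\omega_1}^{b_1}\cdots\int_{\omega_d}^{b_d}\varphi(t)\,dt_d\cdots dt_1.$$ Then $U_{[d]}\varphi\in L^\infty(S)$ and $$\|U_{[d]}\varphi\|_{L^\infty(S)}\le 2^{-d}\|\varphi\|_{L^1(S)}.$$ Moreover, $$\int_S\varphi(\omega)f(\omega)\,d\omega=\int_S(U_{[d]}\varphi)(\omega)\,\partial_{[d]}f(\omega)\,d\omega,$$ and therefore $$\left|\int_S\varphi(\omega)f(\omega)\,d\omega\right|\le 2^{-d}\|\varphi\|_{L^1(S)}\int_S|\partial_{[d]}f(\omega)|\,d\omega.$$ In the smooth Vitali setting, where $V(f;S)=\int_S|\partial_{[d]}f(\omega)|\,d\omega$, this gives $$\left|\int_S\varphi(\omega)f(\omega)\,d\omega\right|\le 2^{-d}\|\varphi\|_{L^1(S)}V(f;S).$$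
   Context: Let $d\ge 1$, $[d]=\{1,\dots,d\}$, and let $S=\prod_{i=1}^d[a_i,b_i]\subset\mathbb R^d$ be a box with $a_i<b_i$. Write $\omega_{-i}=(\omega_j)_{j\ne i}$ and $S_{-i}=\prod_{j\ne i}[a_j,b_j]$; $\varphi(\omega_{-i},t)$ means that $t$ is inserted in the $i$th coordinate. A function $\varphi\in L^1(S)$ is centered on $[d]$ if for every $i\in[d]$ one has $\int_{a_i}^{b_i}\varphi(\omega_{-i},t)\,dt=0$ for a.e. $\omega_{-i}\in S_{-i}$. $\partial_{[d]}f=\partial_1\cdots\partial_df$, and $C^d(\overline S)$ denotes functions that are $C^d$ up to the boundary of $S$. Vitali variation: for a pointwise-defined $f:S\to\mathbb R$, $$V(f;S)=\sup_{\mathcal Q}\sum_{S_j\in\mathcal Q}|\sigma(f,S_j)|,$$ where $\mathcal Q=\{S_j\}$ ranges over finite families of axis-parallel closed boxes $S_j=\prod_{\ell=1}^d[a^j_\ell,b^j_\ell]$ with pairwise disjoint interiors and union $S$, and $$\sigma(f,S_j)=\sum_{\nu\in\{0,1\}^d}(-1)^{\nu_1+\cdots+\nu_d}f\bigl(b^j+\nu\odot(a^j-b^j)\bigr)$$ ($\odot$ is the componentwise product). *)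

(* Defs.v *)
From HB Require Import structures.
From mathcomp Require Import all_boot all_order all_algebra.
From mathcomp Require Import all_classical all_reals all_analysis.

Set Implicit Arguments.
Unset Strict Implicit.
Unset Printing Implicit Defensive.
Import Order.TTheory GRing.Theory Num.Theory.
Import numFieldNormedType.Exports.

Local Open Scope classical_set_scope.
Local Open Scope ring_scope.

(* R^d is 'rV[R]_d, with the topology and norm of the library. *)

(* ins i w t is w with t inserted as its i-th coordinate. *)
Definition ins (T : Type) (d : nat) (i : 'I_d) (w : 'rV[T]_d.-1) (t : T) :
    'rV[T]_d :=
  \row_j (if unlift i j is Some k then w 0 k else t).

(* The product sigma-algebra, as for n.-tuple T; for T = R it is the Borel
   sigma-algebra. *)
Section measurable_rV.
Context {disp : measure_display} {T : measurableType disp}.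
Variable d : nat.

Definition rV_coord : 'I_d -> 'rV[T]_d -> T := fun i x => x 0 i.

Let rV_set0 : g_sigma_preimage rV_coord set0.
Proof. exact: sigma_algebra0. Qed.

Let rV_setC A : g_sigma_preimage rV_coord A -> g_sigma_preimage rV_coord (~` A).
Proof. exact: sigma_algebraC. Qed.

Let rV_bigcup (F : _^nat) : (forall i, g_sigma_preimage rV_coord (F i)) ->
  g_sigma_preimage rV_coord (\bigcup_i (F i)).
Proof. exact: sigma_algebra_bigcup. Qed.

HB.instance Definition _ := @isMeasurable.Build (measure_tuple_display disp)
  'rV[T]_d (g_sigma_preimage rV_coord) rV_set0 rV_setC rV_bigcup.

Lemma measurable_rV_coord (i : 'I_d) :
  measurable_fun [set: 'rV[T]_d] (fun x : 'rV[T]_d => x 0 i).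
Proof.
move=> _ Y mY; rewrite setTI; apply: sub_sigma_algebra => /=.
rewrite -bigcup_seq/=; exists i => /=; first by rewrite mem_index_enum.
by exists Y => //; rewrite setTI.
Qed.

End measurable_rV.

Section measurable_ins.
Context {d1 d2 : measure_display} {T1 : measurableType d1}
  {T2 : measurableType d2}.

Lemma measurable_fun_rVP (n : nat) (f : T1 -> 'rV[T2]_n) :
  measurable_fun [set: T1] f <->
  forall i, measurable_fun [set: T1] (fun x => f x 0 i).
Proof.
apply: (@iff_trans _
  (g_sigma_preimage (fun i => (@rV_coord _ T2 n i) \o f) `<=` measurable)).
  rewrite g_sigma_preimage_comp; split=> [mf A [/= C preC <-]|prefS].
    exact: mf.
  by move=> _ A mA; apply: prefS; exists A.
split=> [fS i|mf].
- move=> _ A mA.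
  apply: fS; apply: sub_sigma_algebra.
  case: n i => [[] []//|n i] in f *.
  rewrite -bigcup_mkord_ord.
  exists i; first exact: ltn_ord.
  by exists A => //; rewrite inord_val.
- apply: smallest_sub; first exact: sigma_algebra_measurable.
  case: n => [|n] in f mf *; first by rewrite big_ord0.
  rewrite -bigcup_mkord_ord; apply: bigcup_sub => i Ii.
  by move=> A [B mB <-]; exact: mf.
Qed.

Lemma measurable_ins (n : nat) (i : 'I_n) (f : T1 -> 'rV[T2]_n.-1)
    (g : T1 -> T2) :
  measurable_fun [set: T1] f -> measurable_fun [set: T1] g ->
  measurable_fun [set: T1] (fun x => ins i (f x) (g x)).
Proof.
move=> mf mg; apply/measurable_fun_rVP => j.
under eq_fun do rewrite mxE.
by case: (unlift i j) => [k|//]; move/measurable_fun_rVP : mf; exact.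
Qed.

End measurable_ins.

(* d-dimensional Lebesgue measure, by recursion on d: the unit point mass on
   R^0, and the image of lebesgue_measure \x lebesgue_rV n under
   (t, w) |-> ins ord0 w t on R^n.+1. *)
Section lebesgue_rV.
Context {R : realType}.

Definition rV_cons (n : nat) (p : measurableTypeR R * 'rV[R]_n) : 'rV[R]_n.+1 :=
  ins ord0 p.2 p.1.

Lemma measurable_rV_cons (n : nat) : measurable_fun setT (@rV_cons n).
Proof.
exact: (@measurable_ins _ _ (measurableTypeR R * 'rV[R]_n)%type R n.+1 ord0
  snd fst).
Qed.

Lemma rV_cons_ins (n : nat) (x : 'rV[R]_n.+1) :
  rV_cons (x 0 ord0, col' ord0 x) = x.
Proof.
apply/rowP => j; rewrite !mxE; case: unliftP => [k ->|-> //].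
by rewrite !mxE.
Qed.

Section step.
Variables (n : nat) (mu : {sigma_finite_measure set 'rV[R]_n -> \bar R}).

Definition lebesgue_rV_step : set 'rV[R]_n.+1 -> \bar R :=
  pushforward (lebesgue_measure \x mu)%E (@rV_cons n).

HB.instance Definition _ := Measure.copy lebesgue_rV_step
  (measure_function_pushforward__canonical__measure_function_Measure
    (lebesgue_measure \x mu)%E (@measurable_rV_cons n)).

Let sigma_finite_step : sigma_finite setT lebesgue_rV_step.
Proof.
have /sigma_finiteP[F [TF ndF Foo]] := sigma_finiteT (@lebesgue_measure R).
have /sigma_finiteP[G [TG ndG Goo]] := sigma_finiteT mu.
pose u (x : 'rV[R]_n.+1) : measurableTypeR R * 'rV[R]_n := (x 0 ord0, col' ord0 x).
have mu_ : measurable_fun setT u.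
  apply/measurable_fun_pairP; split; first exact: measurable_rV_coord.
  apply/measurable_fun_rVP => j; under eq_fun do rewrite mxE.
  exact: measurable_rV_coord.
have uK p : u (rV_cons p) = p.
  case: p => t w; congr (_, _); first by rewrite mxE unlift_none.
  by apply/rowP => j; rewrite !mxE liftK.
exists (fun k => u @^-1` (F k `*` G k)).
  apply/seteqP; split=> // x _.
  have : (\bigcup_i F i) (x 0 ord0) by rewrite -TF.
  have : (\bigcup_i G i) (col' ord0 x) by rewrite -TG.
  move=> [k _ Gk] [l _ Fl]; exists (maxn k l) => //; split.
    by move: Fl; exact/subsetPset/ndF/leq_maxr.
  by move: Gk; exact/subsetPset/ndG/leq_maxl.
move=> k; have [mF Fk] := Foo k; have [mG Gk] := Goo k.
have mFG : measurable (F k `*` G k) by exact: measurableX.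
split; first by rewrite -[X in measurable X]setTI; exact: mu_.
rewrite /lebesgue_rV_step /pushforward /= -comp_preimage.
rewrite (_ : u \o @rV_cons n = id) ?preimage_id//.
  by rewrite product_measure1E// lte_mul_pinfty// ge0_fin_numE.
exact/funext/uK.
Qed.

HB.instance Definition _ := Measure_isSigmaFinite.Build _ _ _
  lebesgue_rV_step sigma_finite_step.

End step.

Fixpoint lebesgue_rV (d : nat) : {sigma_finite_measure set 'rV[R]_d -> \bar R} :=
  match d with
  | 0%N => \d_(0 : 'rV[R]_0)
  | n.+1 => lebesgue_rV_step (lebesgue_rV n)
  end.

End lebesgue_rV.

Section box.
Context {R : realType}.

Definition box (d : nat) (a b : 'rV[R]_d) : set 'rV[R]_d :=
  [set x | forall i, x 0 i \in `[a 0 i, b 0 i]].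

Lemma measurable_box (d : nat) (a b : 'rV[R]_d) : measurable (box a b).
Proof.
rewrite (_ : box a b =
  \bigcap_(i in [set: 'I_d]) [set x : 'rV[R]_d | x 0 i \in `[a 0 i, b 0 i]]).
  apply: fin_bigcap_measurable => // i _.
  have := @measurable_rV_coord _ R d i measurableT _
    (measurable_itv `[a 0 i, b 0 i]).
  by rewrite setTI.
by apply/seteqP; split=> [x h i _|x h i]; exact: h.
Qed.

Lemma lebesgue_rV_box (d : nat) (a b : 'rV[R]_d) :
  (forall i, a 0 i <= b 0 i) ->
  lebesgue_rV d (box a b) = (\prod_i (b 0 i - a 0 i))%:E.
Proof.
elim: d a b => [|n IH] a b ab.
  by rewrite big_ord0 /= diracE mem_set// => -[].
rewrite big_ord_recl /= /lebesgue_rV_step /pushforward.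
rewrite (_ : _ @^-1` _ =
    [set` `[a 0 ord0, b 0 ord0]] `*` box (col' ord0 a) (col' ord0 b)); last first.
  apply/seteqP; split=> -[t w] /=.
    move=> h; split; first by have := h ord0; rewrite mxE unlift_none.
    by move=> i /=; have := h (lift ord0 i); rewrite !mxE liftK.
  move=> [ht hw] i; rewrite mxE; case: unliftP => [k ->|->//].
  by have := hw k; rewrite !mxE.
rewrite product_measure1E//=; last exact: measurable_box.
rewrite IH; last by move=> i; rewrite !mxE.
rewrite lebesgue_measure_itv/= lte_fin.
under eq_bigr do rewrite !mxE.
case: ltP => [_|ba]; first by rewrite -EFinB -EFinM.
have -> : a 0 ord0 = b 0 ord0 by apply/eqP; rewrite eq_le ab ba.
by rewrite subrr mul0r mul0e.
Qed.

End box.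

Section functions_on_box.
Context {R : realType} {d : nat}.
Implicit Types (S : set 'rV[R]_d) (a b : 'rV[R]_d) (f phi : 'rV[R]_d -> R).

(* L^p(S), for measurable S: extension by 0 identifies it with the functions of
   L^p(R^d) vanishing outside S. *)
Definition LfunS S (p : \bar R) phi : Prop :=
  (phi \_ S : 'rV[R]_d -> R) \in Lfun (lebesgue_rV d) p.

Definition LnormS S (p : \bar R) phi : \bar R :=
  ('N[lebesgue_rV d]_p [EFin \o (phi \_ S)])%E.

Definition centered a b phi : Prop :=
  forall i : 'I_d, {ae lebesgue_rV d.-1, forall w,
    box (col' i a) (col' i b) w ->
    (\int[lebesgue_measure]_(t in `[a 0%R i, b 0%R i]) (phi (ins i w t))%:E = 0)%E}.

Definition tail_int1 b (i : 'I_d) phi : 'rV[R]_d -> R :=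
  fun w => \int[lebesgue_measure]_(t in `[w 0 i, b 0 i]) phi (ins i (col' i w) t).

(* foldr makes the integral in the first coordinate the outermost one. *)
Definition tail_int b phi : 'rV[R]_d -> R :=
  foldr (tail_int1 b) phi (enum 'I_d).

(* partials [:: i1; ...; ik] f = 'D_i1 (... ('D_ik f)). *)
Definition partials (s : seq 'I_d) f : 'rV[R]_d -> R :=
  foldr (fun i g => 'D_(delta_mx 0 i) g) f s.

(* C^k up to the boundary of S: f is continuous on S, all iterated partial
   derivatives of order at most k exist in the interior of S, and each of them
   coincides there with a continuous function on S. *)
Definition Ck_upto_bdry (k : nat) S f : Prop :=
  {within S, continuous f} /\
  forall s : seq 'I_d, (size s <= k)%N ->
    ((size s < k)%N -> forall x i, (S°) x ->
       derivable (partials s f) x (delta_mx 0 i)) /\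
    exists2 g : 'rV[R]_d -> R, {within S, continuous g} &
      forall x, (S°) x -> partials s f x = g x.

(* The value on S of a function given on the interior of S and extended by
   continuity to the boundary. *)
Definition bdry_ext S f : 'rV[R]_d -> R :=
  fun x => lim (f @ within (S°) (nbhs x)).

Definition mixed_partial S f : 'rV[R]_d -> R :=
  bdry_ext S (partials (enum 'I_d) f).

Definition is_box_partition S (Q : seq ('rV[R]_d * 'rV[R]_d)) : Prop :=
  [/\ forall q, q \in Q -> forall i, q.1 0 i < q.2 0 i,
      forall j k, (j < k < size Q)%N ->
        (box (nth 0 Q j).1 (nth 0 Q j).2)° `&`
        (box (nth 0 Q k).1 (nth 0 Q k).2)° = set0 &
      \bigcup_(q in [set` Q]) box q.1 q.2 = S].

Definition alt_vertex_sum f (q : 'rV[R]_d * 'rV[R]_d) : R :=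
  \sum_(nu : {ffun 'I_d -> bool})
    (-1) ^+ (\sum_i nu i)%N *
    f (\row_i (q.2 0 i + (nu i)%:R * (q.1 0 i - q.2 0 i))).

Definition vitali_variation S f : \bar R :=
  ereal_sup [set (\sum_(q <- Q) `|alt_vertex_sum f q|)%:E
            | Q in is_box_partition S].

End functions_on_box.

(* Main.v *)
Require Import Defs.
From mathcomp Require Import all_boot all_order all_algebra.
From mathcomp Require Import all_classical all_reals all_analysis.
From mathcomp Require Import measurable_realfun ess_sup_inf.
From mathcomp Require Import ring lra.

(** Why the theorem holds.

For a centered [phi] the integral of [phi * h] over [S] vanishes as soon as [h]
does not depend on one of the coordinates: on almost every line in that
direction [h] is constant and [phi] has integral 0 ([centered_integral_eq0]).
Hence in a sum of functions [h nu] indexed by the subsets [nu] of the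
coordinates, where [h nu] does not depend on the coordinates in [nu], only the
term of the empty subset contributes ([centered_integral_sum]). This is used
twice.

First, the iterated integral defining the tail [U phi (w)] is the integral of
[phi] over the box between [w] and [b] ([tail_int_box]), that is, the integral
over [S] of [phi(t)] times the product of the indicators of [w_i <= t_i]. That
product is the empty-subset term in the expansion of
[\prod_i (1_{w_i <= t_i} - 1/2)], whose modulus is [2^-d] everywhere; so the
tail is bounded by [2^-d] times the L1 norm of [phi] ([centered_tail_bound]).

Secondly, [f(w)] is the empty-subset term of the alternating sum of [f] over the
vertices of the box between [a] and [w]; so [f] may be replaced by that sum
under the integral against [phi]. The sum is the integral of the mixed partial
derivative over the box ([ftc_closed_box]), and exchanging the two integrals
turns [phi] into its tail ([integral_tail_duality],
[tail_integration_by_parts]).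

The identity between alternating sums and integrals of the mixed partial
derivative also gives the Vitali variation ([vitali_variation_integral]). It
is proved by induction on the dimension for boxes inside the interior of [S]
([ftc_box]), and reaches the boxes that touch the boundary, where no derivative
need exist, by shrinking them towards the centre of [S] and passing to the limit. *)

Set Implicit Arguments.
Unset Strict Implicit.
Unset Printing Implicit Defensive.
Import Order.TTheory GRing.Theory Num.Theory.
Import numFieldNormedType.Exports.
Local Open Scope classical_set_scope.
Local Open Scope ring_scope.

(** * Slices of vectors and of Lebesgue measure *)

Section insert_coordinate.
Context {T : Type} {n : nat}.
Implicit Types (i : 'I_n.+1) (w : 'rV[T]_n) (x : 'rV[T]_n.+1).

Lemma ins_id i w t : @ins T n.+1 i w t 0 i = t.
Proof. by rewrite mxE unlift_none. Qed.

Lemma ins_lift i w t k : @ins T n.+1 i w t 0 (lift i k) = w 0 k.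
Proof. by rewrite mxE liftK. Qed.

End insert_coordinate.

Lemma ins_ins0 (T : Type) n (j : 'I_n.+1) (v : 'rV[T]_n) (s t : T) :
  @ins T n.+2 (lift ord0 j) (@ins T n.+1 ord0 v t) s =
  @ins T n.+2 ord0 (@ins T n.+1 j v s) t.
Proof.
apply/rowP => k.
case: (unliftP (lift ord0 j) k) => [k1 ->|->]; last first.
  by rewrite ins_id ins_lift ins_id.
rewrite ins_lift; case: (unliftP ord0 k1) => [k2 ->|->].
  have -> : lift (lift ord0 j) (lift ord0 k2) = lift ord0 (lift j k2).
    by apply/val_inj; rewrite /= /bump /= !add1n ltnS; case: leqP.
  by rewrite !ins_lift.
have -> : lift (lift ord0 j) ord0 = ord0 by apply/val_inj.
by rewrite !ins_id.
Qed.

Section slicing_first_coordinate.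
Context {R : realType}.
Local Open Scope ereal_scope.

Lemma measurable_ins_pair n (i : 'I_n.+1) :
  measurable_fun [set: measurableTypeR R * 'rV[R]_n]
    (fun p => ins i p.2 p.1 : 'rV[R]_n.+1).
Proof.
exact: (@measurable_ins _ _ (measurableTypeR R * 'rV[R]_n)%type R n.+1 i
  snd fst).
Qed.


Lemma ge0_integral_ins0 n (F : 'rV[R]_n.+1 -> \bar R) :
  measurable_fun setT F -> (forall x, 0 <= F x) ->
  \int[lebesgue_rV n.+1]_x F x =
  \int[lebesgue_measure]_t \int[lebesgue_rV n]_w F (ins ord0 w t).
Proof.
move=> mF F0.
have mi := measurable_ins_pair (@ord0 n).
rewrite -(fubini_tonelli1 (fun p : measurableTypeR R * 'rV[R]_n =>
  F (ins ord0 p.2 p.1))) //; last exact: (measurableT_comp mF mi).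
exact: (@ge0_integral_pushforward _ _ _ _ R _ mi
  (lebesgue_measure \x lebesgue_rV n) setT F measurableT mF (fun x _ => F0 x)).
Qed.


End slicing_first_coordinate.

(* Unification would otherwise unfold the recursion that defines the measure. *)
Local Opaque lebesgue_rV.

Section slicing.
Context {R : realType}.
Local Open Scope ereal_scope.

(** The measure is defined by splitting off coordinate 0; by Tonelli every
coordinate can play that role. Induction on the dimension: coordinate 0 is split
off before coordinate [i] on one side and after it on the other, and the two
one-dimensional integrals are exchanged. *)
Lemma ge0_integral_ins n (i : 'I_n.+1) (F : 'rV[R]_n.+1 -> \bar R) :
  measurable_fun setT F -> (forall x, 0 <= F x) ->
  \int[lebesgue_rV n.+1]_x F x =
  \int[lebesgue_measure]_t \int[lebesgue_rV n]_w F (ins i w t).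
Proof.
elim: n i F => [|n IH] i F mF F0; first by rewrite (ord1 i) ge0_integral_ins0.
rewrite (ge0_integral_ins0 mF F0); case: (unliftP ord0 i) => [j ->|->//].
have mFi (k : 'I_n.+2) : measurable_fun [set: measurableTypeR R * 'rV[R]_n.+1]
    (fun p : measurableTypeR R * 'rV[R]_n.+1 => F (ins k p.2 p.1)).
  exact: (measurableT_comp mF (measurable_ins_pair k)).
under eq_integral => t _.
  rewrite (IH j)//; last exact: (measurableT_comp (mFi ord0) (measurable_pair1 t)).
  over.
have mFj : measurable_fun setT (fun q : measurableTypeR R * measurableTypeR R =>
   \int[lebesgue_rV n]_v F (ins ord0 (ins j v q.2) q.1)).
  apply: (@measurable_fun_fubini_tonelli_F _ _ _ _ R (lebesgue_rV n)
    (fun z : (measurableTypeR R * measurableTypeR R) * 'rV[R]_n =>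
      F (ins ord0 (ins j z.2 z.1.2) z.1.1))) => //.
  apply: (measurableT_comp mF).
  apply: measurable_ins.
    apply: measurable_ins => //.
    by apply: (measurableT_comp measurable_snd measurable_fst).
  by apply: (measurableT_comp measurable_fst measurable_fst).
rewrite (fubini_tonelli (fun q : measurableTypeR R * measurableTypeR R =>
  \int[lebesgue_rV n]_v F (ins ord0 (ins j v q.2) q.1)))//; last first.
  by move=> q; apply: integral_ge0.
apply: eq_integral => s _.
under eq_integral do under eq_integral do rewrite -ins_ins0.
rewrite ge0_integral_ins0//.
exact: (measurableT_comp (mFi (lift ord0 j)) (measurable_pair1 s)).
Qed.

Lemma lebesgue_rV_ins n (i : 'I_n.+1) (A : set 'rV[R]_n.+1) : measurable A ->
  lebesgue_rV n.+1 A =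
  pushforward (lebesgue_measure \x lebesgue_rV n)
    (fun p : measurableTypeR R * 'rV[R]_n => ins i p.2 p.1) A.
Proof.
move=> mA; have mi := @measurable_ins_pair R n i.
have -> : lebesgue_rV n.+1 A = \int[lebesgue_rV n.+1]_x (\1_A x)%:E.
  by rewrite integral_indic// setIT.
rewrite (ge0_integral_ins i)//; last first.
  by apply/measurable_EFinP; exact: measurable_indic.
pose B : set (measurableTypeR R * 'rV[R]_n) :=
  (fun p => ins i p.2 p.1) @^-1` A.
have mB : measurable B by rewrite -[X in measurable X]setTI; exact: mi.
rewrite -[RHS](_ : \int[lebesgue_measure \x lebesgue_rV n]_p (\1_B p)%:E = _).
  rewrite fubini_tonelli1//; first by apply/measurable_EFinP; exact: measurable_indic.
by rewrite integral_indic// setIT.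
Qed.

Lemma integrable_ins n (i : 'I_n.+1) (F : 'rV[R]_n.+1 -> \bar R) :
  (lebesgue_rV n.+1).-integrable setT F ->
  (lebesgue_measure \x lebesgue_rV n).-integrable setT
    (fun p : measurableTypeR R * 'rV[R]_n => F (ins i p.2 p.1)).
Proof.
move=> /integrableP[mF iF]; have mi := @measurable_ins_pair R n i.
apply/integrableP; split; first exact: (measurableT_comp mF mi).
rewrite fubini_tonelli1//=; last first.
  by apply: measurableT_comp => //; exact: (measurableT_comp mF mi).
have mF' : measurable_fun setT (abse \o F) by exact: measurableT_comp.
by rewrite -(ge0_integral_ins i mF' (fun x => abse_ge0 _)).
Qed.

Lemma integral_ins n (i : 'I_n.+1) (F : 'rV[R]_n.+1 -> \bar R) :
  (lebesgue_rV n.+1).-integrable setT F ->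
  \int[lebesgue_rV n.+1]_x F x = \int[lebesgue_measure \x lebesgue_rV n]_p
    F (ins i p.2 p.1).
Proof.
move=> iF; have mi := @measurable_ins_pair R n i.
rewrite (eq_measure_integral (pushforward (lebesgue_measure \x lebesgue_rV n)
    (fun p : measurableTypeR R * 'rV[R]_n => ins i p.2 p.1))); last first.
  by move=> A mA _; exact: lebesgue_rV_ins.
by rewrite (integral_pushforward mi (measurable_int _ iF) _ measurableT)//;
  exact: integrable_ins.
Qed.


End slicing.

(** * Fubini on a box, in every coordinate *)

Section box_slicing.
Context {R : realType}.
Local Open Scope ereal_scope.

Lemma lebesgue_rV_hyperplane n (i : 'I_n) (c : R) :
  lebesgue_rV n [set x : 'rV[R]_n | x 0%R i = c] = 0.
Proof.
case: n i => [[]//|n i].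
have mc : measurable [set x : 'rV[R]_n.+1 | x 0%R i = c].
  rewrite -[X in measurable X]setTI.
  exact: (@measurable_rV_coord _ R n.+1 i measurableT [set c]).
rewrite (lebesgue_rV_ins i)// /pushforward.
rewrite (_ : _ @^-1` _ = [set c] `*` setT); last first.
  apply/seteqP; split=> -[t w] /=; rewrite ins_id //.
  by case.
by rewrite product_measure1E//= lebesgue_measure_set1 mul0e.
Qed.

Lemma box_ins n (i : 'I_n.+1) (a b : 'rV[R]_n.+1) w t :
  box a b (ins i w t) <->
  t \in `[a 0%R i, b 0%R i] /\ box (col' i a) (col' i b) w.
Proof.
split=> [h|[ti wi] k].
  split; first by have := h i; rewrite ins_id.
  by move=> k /=; have := h (lift i k); rewrite ins_lift !mxE.
case: (unliftP i k) => [l ->|->]; last by rewrite ins_id.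
by have := wi l; rewrite ins_lift !mxE.
Qed.

(** Turns integrals over a box into integrals over the whole space, where Fubini
applies. *)
Lemma patch_box_ins n (i : 'I_n.+1) (a b : 'rV[R]_n.+1)
    (F : 'rV[R]_n.+1 -> \bar R) w t :
  (F \_ (box a b)) (ins i w t) =
  ((fun t => ((fun w => F (ins i w t)) \_ (box (col' i a) (col' i b))) w)
    \_ [set` `[a 0%R i, b 0%R i]]) t.
Proof.
rewrite !patchE; have := @box_ins n i a b w t.
case: ifPn => [|]; rewrite ?inE ?notin_setE => h [h1 h2].
  by rewrite ifT ?inE//; [rewrite ifT ?inE//; case: (h1 h)|case: (h1 h)].
case: ifPn => // /[!inE] ht; case: ifPn => // /[!inE] hw.
by exfalso; apply: h; exact: h2.
Qed.

Section integral.
Variables (n : nat) (i : 'I_n.+1) (a b : 'rV[R]_n.+1) (F : 'rV[R]_n.+1 -> \bar R).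
Hypothesis iF : (lebesgue_rV n.+1).-integrable (box a b) F.
Let B := box (col' i a) (col' i b).
Let I : set (measurableTypeR R) := [set` `[a 0%R i, b 0%R i]].
Let mB : measurable B. Proof. exact: measurable_box. Qed.
Let mI : measurable I. Proof. exact: measurable_itv. Qed.
Let G (p : measurableTypeR R * 'rV[R]_n) := (F \_ (box a b)) (ins i p.2 p.1).
Let iF' : (lebesgue_rV n.+1).-integrable setT (F \_ (box a b)).
Proof. exact/(integrable_mkcond F (measurable_box a b)). Qed.
Let iG : (lebesgue_measure \x lebesgue_rV n).-integrable setT G.
Proof. exact: integrable_ins. Qed.

Let G1 t : I t -> (fun w => G (t, w)) = (fun w => F (ins i w t)) \_ B.
Proof.
by move=> It; apply/funext => w; rewrite /G patch_box_ins patchE ifT// inE.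
Qed.
Let G1N t : ~ I t -> (fun w => G (t, w)) = cst 0.
Proof.
move=> It; apply/funext => w; rewrite /G patch_box_ins patchE ifF//.
by apply/negbTE/negP; rewrite inE.
Qed.
Let G2 w : B w -> (fun t => G (t, w)) = (fun t => F (ins i w t)) \_ I.
Proof.
move=> Bw; apply/funext => t; rewrite /G patch_box_ins !patchE.
by case: ifPn => // _; rewrite ifT// inE.
Qed.
Let G2N w : ~ B w -> (fun t => G (t, w)) = cst 0.
Proof.
move=> Bw; apply/funext => t; rewrite /G patch_box_ins !patchE.
by case: ifPn => // _; rewrite ifF//; apply/negbTE/negP; rewrite inE.
Qed.

Lemma ae_integrable_box_ins : {ae lebesgue_measure, forall t : measurableTypeR R,
  t \in `[a 0%R i, b 0%R i] ->
  (lebesgue_rV n).-integrable B (fun w => F (ins i w t))}.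
Proof.
have := ae_integrable1 iG; apply: filterS => t h It.
by apply/(integrable_mkcond _ mB); rewrite -G1.
Qed.

Lemma ae_integrable_box_insr : {ae lebesgue_rV n, forall w, B w ->
  lebesgue_measure.-integrable `[a 0%R i, b 0%R i] (fun t => F (ins i w t))}.
Proof.
have := ae_integrable2 iG; apply: filterS => w h Bw.
by apply/(integrable_mkcond _ mI); rewrite -G2.
Qed.

Lemma integral_box_ins : \int[lebesgue_rV n.+1]_(x in box a b) F x =
  \int[lebesgue_measure]_(t in `[a 0%R i, b 0%R i]) \int[lebesgue_rV n]_(w in B)
    F (ins i w t).
Proof.
rewrite integral_mkcond (integral_ins i)// -/G -(integral12_prod_meas1 iG).
rewrite [RHS]integral_mkcond; apply: eq_integral => t _; rewrite /fubini_F.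
have [It|It] := pselect (I t).
  by rewrite G1// patchE ifT ?inE// -integral_mkcond.
rewrite G1N// integral_cst// mul0e patchE ifF//.
by apply/negbTE/negP; rewrite inE.
Qed.

Lemma integral_box_insr : \int[lebesgue_rV n.+1]_(x in box a b) F x =
  \int[lebesgue_rV n]_(w in B) \int[lebesgue_measure]_(t in `[a 0%R i, b 0%R i])
    F (ins i w t).
Proof.
rewrite integral_mkcond (integral_ins i)// -/G -(integral21_prod_meas1 iG).
rewrite [RHS]integral_mkcond; apply: eq_integral => w _; rewrite /fubini_G.
have [It|It] := pselect (B w).
  by rewrite G2// patchE ifT ?inE// -integral_mkcond.
rewrite G2N// integral_cst// mul0e patchE ifF//.
by apply/negbTE/negP; rewrite inE.
Qed.

End integral.
End box_slicing.

(** * Continuous functions on a box are integrable *)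

Section topology.
Context {R : realType} {n : nat}.
Implicit Types (x y a b : 'rV[R]_n) (f : 'rV[R]_n -> R).

Lemma rV_ballP x (e : R) y : 0 < e ->
  ball x e y <-> forall i, `|x 0 i - y 0 i| < e.
Proof.
move=> e0; split=> [[_ h] i|h]; first exact: h.
by split=> // i j; rewrite ord1; exact: h.
Qed.

Lemma measurable_rV_ball x (e : R) : 0 < e -> measurable (ball x e).
Proof.
move=> e0; rewrite (_ : ball x e =
    \bigcap_(i in [set: 'I_n]) [set y : 'rV[R]_n | ball (x 0 i) e (y 0 i)]).
  apply: fin_bigcap_measurable => // i _.
  rewrite -[X in measurable X]setTI.
  exact: (@measurable_rV_coord _ R n i measurableT _ (measurable_ball _ _)).
apply/seteqP; split=> y.
  by move=> [_ h] i _; exact: h.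
by move=> h; apply/rV_ballP => // i; exact: h.
Qed.

(** The measurable structure is the product one, generated by the coordinates. It
contains the balls, and the balls with rational centre and radius [1/(k+1)] form
a countable base of the topology. *)
Lemma open_measurable_rV (U : set 'rV[R]_n) : open U -> measurable U.
Proof.
move=> oU; pose B (p : 'rV[rat]_n * nat) : set 'rV[R]_n :=
  ball (\row_i ratr (p.1 0 i) : 'rV[R]_n) p.2.+1%:R^-1.
pose F p := if `[< B p `<=` U >] then B p else set0.
rewrite (_ : U = \bigcup_p F p).
  apply: countable_bigcupT_measurable => // p; rewrite /F; case: ifP => // _.
  by apply: measurable_rV_ball; rewrite invr_gt0 ltr0n.
apply/seteqP; split=> [x Ux|x [p _]]; last first.
  by rewrite /F; case: ifPn => // /asboolP; exact.
have /nbhs_ballP[e /= e0 eU] : nbhs x U by exact: open_nbhs_nbhs.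
have [k ke] : exists k : nat, k.+1%:R^-1 < e / 2.
  have [k] : exists k, 0 + k.+1%:R^-1 < e / 2.
    by apply: ltr_add_invr; rewrite divr_gt0.
  by rewrite add0r; exists k.
have k0 : (0 : R) < k.+1%:R^-1 by rewrite invr_gt0 ltr0n.
have /choice[q qP] i : exists q : rat, `|ratr q - x 0 i| < k.+1%:R^-1.
  have /rat_in_itvoo[q] : x 0 i - k.+1%:R^-1 < x 0 i + k.+1%:R^-1.
    by rewrite ltrBlDr -addrA ltrDl addr_gt0.
  by rewrite in_itv/= -ltr_distl => qx; exists q.
have Bx : B (\row_i q i, k) x by apply/rV_ballP => // i; rewrite !mxE.
exists (\row_i q i, k) => //; rewrite /F ifT//; apply/asboolP => y By.
apply: eU; apply/rV_ballP => // i.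
move: By Bx => /(rV_ballP _ _ k0)/(_ i) h1 /(rV_ballP _ _ k0)/(_ i) h2.
rewrite !mxE in h1 h2.
rewrite (splitr e) -(subrKA (ratr (q i))).
apply: le_lt_trans (ler_normD _ _) _; rewrite ltrD//.
  by rewrite distrC (lt_trans h2).
by rewrite (lt_trans h1).
Qed.

Lemma within_continuous_measurable_fun (D : set 'rV[R]_n) f :
  measurable D -> {within D, continuous f} -> measurable_fun D f.
Proof.
move=> mD /continuousP cf; apply: (measurability _ (RGenOpens.measurableE R)).
move=> _ [_ [a [b ->] <-]].
have /cf/open_subspaceP[V oV VD] : open `]a, b[%classic by exact: interval_open.
by rewrite setIC -VD; apply: measurableI => //; exact: open_measurable_rV.
Qed.

Lemma box_compact a b : compact (box a b).
Proof.
apply: (@rV_compact R n (fun i => [set` `[a 0 i, b 0 i]])) => i.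
exact: segment_compact.
Qed.

Lemma lebesgue_rV_box_fin a b : (lebesgue_rV n (box a b) < +oo)%E.
Proof.
have [ab|/existsNP[i /negP]] := pselect (forall i, a 0 i <= b 0 i).
  by rewrite lebesgue_rV_box// ltry.
rewrite -ltNge => ba; rewrite (_ : box a b = set0) ?measure0//.
apply/seteqP; split=> x // /(_ i); rewrite in_itv/= => /andP[ax xb].
by have := le_lt_trans (le_trans ax xb) ba; rewrite ltxx.
Qed.

Lemma continuous_bounded_box a b f : {within box a b, continuous f} ->
  exists2 M, 0 <= M & forall x, box a b x -> `|f x| <= M.
Proof.
move=> cf.
have /compact_bounded[M [_ Mf]] := continuous_compact cf (@box_compact a b).
exists (`|M| + 1) => [|x bx]; first by rewrite addr_ge0.
by apply: Mf; [rewrite ltr_pwDr// ler_norm|exists x].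
Qed.

Lemma continuous_box_integrable a b f : {within box a b, continuous f} ->
  (lebesgue_rV n).-integrable (box a b) (EFin \o f).
Proof.
move=> cf; have mB := measurable_box a b; apply: measurable_bounded_integrable => //.
- exact: lebesgue_rV_box_fin.
- exact: within_continuous_measurable_fun.
- have [M M0 Mf] := continuous_bounded_box cf.
  exists M; split; first exact: num_real.
  by move=> y My x bx; apply: le_trans (Mf x bx) (ltW My).
Qed.

End topology.

(** * The fundamental theorem of calculus on interior boxes *)

Section ftc.
Context {R : realType}.

Lemma ftc_segment (G g : R -> R) (p q : R) : p <= q ->
  (forall t, t \in `[p, q] ->
    [/\ derivable G t 1, 'D_1 G t = g t & {for t, continuous g}]) ->
  (\int[lebesgue_measure]_(t in `[p, q]) (g t)%:E = (G q - G p)%:E)%E.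
Proof.
rewrite le_eqVlt => /orP[/eqP <- _|pq Gg].
  by rewrite set_itv1 integral_set1 subrr.
have cG t : t \in `[p, q] -> {for t, continuous G}.
  by move=> /Gg[dG _ _]; exact/differentiable_continuous/derivable1_diffP.
have sub t : t \in `]p, q[ -> t \in `[p, q] by exact: subset_itv_oo_cc.
rewrite (@continuous_FTC2 R g G p q)// ?EFinB//.
- by apply: continuous_in_subspaceT => t /[!inE] /Gg[].
- split => [t /sub/Gg[]//||].
    by apply: cvg_at_right_filter; apply: cG; rewrite in_itv/= lexx ltW.
  by apply: cvg_at_left_filter; apply: cG; rewrite in_itv/= lexx ltW.
- by move=> t /sub/Gg[_ <- _]; rewrite derive1E.
Qed.

Section slice.
Variable n : nat.
Implicit Types (w : 'rV[R]_n) (t h : R) (f : 'rV[R]_n.+1 -> R).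

Lemma scale_delta_ins (i : 'I_n.+1) (k : 'I_n) w t h :
  h *: delta_mx 0 (lift i k) + ins i w t =
  ins i (h *: delta_mx 0 k + w) t :> 'rV[R]_n.+1.
Proof.
apply/rowP => j; rewrite !mxE /=; case: unliftP => [l ->|->].
  by rewrite !mxE (inj_eq (@lift_inj _ i)).
by rewrite (negbTE (neq_lift _ _)) mulr0 add0r.
Qed.

Lemma scale_delta_ins_id (i : 'I_n.+1) w t h :
  h *: delta_mx 0 i + ins i w t = ins i w (h + t) :> 'rV[R]_n.+1.
Proof.
apply/rowP => j; rewrite !mxE /=; case: unliftP => [l ->|->].
  by rewrite (eq_sym _ i) (negbTE (neq_lift _ _)) mulr0 add0r.
by rewrite eqxx mulr1.
Qed.

Let slice_quotient f (i : 'I_n.+1) (k : 'I_n) w t :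
  (fun h => h^-1 *: ((f \o shift (ins i w t)) (h *: delta_mx 0 (lift i k)) -
     f (ins i w t))) =
  (fun h => h^-1 *: (((fun w => f (ins i w t)) \o shift w) (h *: delta_mx 0 k) -
     f (ins i w t))).
Proof. by apply/funext => h /=; rewrite scale_delta_ins. Qed.

Let line_quotient f (i : 'I_n.+1) w t :
  (fun h => h^-1 *: ((f \o shift (ins i w t)) (h *: delta_mx 0 i) -
     f (ins i w t))) =
  (fun h : R => h^-1 *: (((fun t => f (ins i w t)) \o shift t) (h *: 1) -
     f (ins i w t))).
Proof.
by apply/funext => h /=; rewrite scale_delta_ins_id [h%:A](mulr1).
Qed.

Lemma derive_slice f (i : 'I_n.+1) (k : 'I_n) w t :
  'D_(delta_mx 0 (lift i k)) f (ins i w t) =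
  'D_(delta_mx 0 k) (fun w => f (ins i w t)) w.
Proof. by rewrite /derive slice_quotient. Qed.

Lemma derivable_slice f (i : 'I_n.+1) (k : 'I_n) w t :
  derivable f (ins i w t) (delta_mx 0 (lift i k)) ->
  derivable (fun w => f (ins i w t)) w (delta_mx 0 k).
Proof. by rewrite /derivable slice_quotient. Qed.

Lemma derive_line f (i : 'I_n.+1) w t :
  'D_(delta_mx 0 i) f (ins i w t) = 'D_1 (fun t => f (ins i w t)) t.
Proof. by rewrite /derive line_quotient. Qed.

Lemma derivable_line f (i : 'I_n.+1) w t :
  derivable f (ins i w t) (delta_mx 0 i) ->
  derivable (fun t => f (ins i w t)) t 1.
Proof. by rewrite /derivable line_quotient. Qed.

Lemma partials_slice f (i : 'I_n.+1) (s : seq 'I_n) t :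
  (fun w => partials (map (lift i) s) f (ins i w t)) =
  partials s (fun w => f (ins i w t)).
Proof.
elim: s => //= k s IH; apply/funext => w.
by rewrite derive_slice IH.
Qed.

Lemma continuous_slice (i : 'I_n.+1) t :
  continuous (fun w => ins i w t : 'rV[R]_n.+1).
Proof.
move=> w U /nbhs_ballP[e /= e0 eU]; apply/nbhs_ballP; exists e => //= v wv.
apply: eU; apply/rV_ballP => // j; rewrite !mxE.
case: unliftP => [k _|_]; last by rewrite subrr normr0.
by move/(rV_ballP _ _ e0) : wv; exact.
Qed.

Lemma continuous_line (i : 'I_n.+1) w :
  continuous (fun t : R => ins i w t : 'rV[R]_n.+1).
Proof.
move=> t U /nbhs_ballP[e /= e0 eU]; apply/nbhs_ballP; exists e => //= v tv.
apply: eU; apply/rV_ballP => // j; rewrite !mxE.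
by case: unliftP => [k _|_//]; rewrite subrr normr0.
Qed.

End slice.

Lemma alt_vertex_sum_ins0 n (f : 'rV[R]_n.+1 -> R) (p q : 'rV[R]_n.+1) :
  alt_vertex_sum f (p, q) =
  alt_vertex_sum (fun w => f (ins ord0 w (q 0 ord0))) (col' ord0 p, col' ord0 q) -
  alt_vertex_sum (fun w => f (ins ord0 w (p 0 ord0))) (col' ord0 p, col' ord0 q).
Proof.
pose V (b : bool) (nu : {ffun 'I_n -> bool}) : {ffun 'I_n.+1 -> bool} :=
  [ffun i => if unlift ord0 i is Some k then nu k else b].
pose W (nu : {ffun 'I_n.+1 -> bool}) : bool * {ffun 'I_n -> bool} :=
  (nu ord0, [ffun k => nu (lift ord0 k)]).
rewrite /alt_vertex_sum.
rewrite (reindex (fun x : bool * {ffun 'I_n -> bool} => V x.1 x.2)) /=; last first.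
  exists W => [[b nu] _|nu _]; rewrite /W /V /=.
    by rewrite ffunE unlift_none; congr (_, _); apply/ffunP => k; rewrite !ffunE liftK.
  by apply/ffunP => i; rewrite ffunE; case: unliftP => [k ->|->]; rewrite ?ffunE.
rewrite -(pair_bigA _ (fun b nu => (-1) ^+ (\sum_i V b nu i)%N *
   f (\row_i (q 0 i + (V b nu i)%:R * (p 0 i - q 0 i))))) /= big_bool /= addrC.
have E b nu : f (\row_i (q 0 i + (V b nu i)%:R * (p 0 i - q 0 i))) =
   f (ins ord0 (\row_i (col' ord0 q 0 i +
                        (nu i)%:R * (col' ord0 p 0 i - col' ord0 q 0 i)))
      (if b then p 0 ord0 else q 0 ord0)).
  congr f; apply/rowP => i; rewrite !mxE ffunE; case: unliftP => [k ->|->].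
    by rewrite !mxE.
  by case: b; rewrite ?mul1r ?mul0r ?addr0 // addrC subrK.
have S b nu : (\sum_i V b nu i = b + \sum_i nu i)%N.
  rewrite big_ord_recl ffunE unlift_none; congr addn.
  by apply: eq_bigr => k _; rewrite ffunE liftK.
congr (_ + _); first by apply: eq_bigr => nu _; rewrite E S add0n.
rewrite -sumrN; apply: eq_bigr => nu _.
by rewrite E S exprD expr1 mulN1r mulNr.
Qed.

(** The regularity needed to differentiate [f] along the directions of [s], the last
one first: the intermediate derivatives are indexed by the suffixes of [s]. *)
Definition smooth_along n (s : seq 'I_n) (B : set 'rV[R]_n) (f : 'rV[R]_n -> R) :=
  (forall t r, s = t ++ r -> forall x, B x -> {for x, continuous (partials r f)}) /\
  (forall t k r, s = t ++ k :: r ->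
     forall x, B x -> derivable (partials r f) x (delta_mx 0 k)).

Lemma smooth_along_slice n (f : 'rV[R]_n.+1 -> R) (a b : 'rV[R]_n.+1) t :
  t \in `[a 0 ord0, b 0 ord0] ->
  smooth_along (enum 'I_n.+1) (box a b) f ->
  smooth_along (enum 'I_n) (box (col' ord0 a) (col' ord0 b))
    (fun w => f (ins ord0 w t)).
Proof.
move=> tab [cf df]; split=> [u r|u k r] ur w Bw.
  have Bx : box a b (ins ord0 w t) by apply/box_ins.
  have : {for ins ord0 w t, continuous (partials (map (lift ord0) r) f)}.
    by apply: (cf (ord0 :: map (lift ord0) u)) => //; rewrite enum_ordSl ur map_cat.
  by move=> /(continuous_comp (@continuous_slice _ ord0 t w)); rewrite -partials_slice.
have Bx : box a b (ins ord0 w t) by apply/box_ins.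
have : derivable (partials (map (lift ord0) r) f) (ins ord0 w t)
     (delta_mx 0 (lift ord0 k)).
  by apply: (df (ord0 :: map (lift ord0) u)) => //; rewrite enum_ordSl ur map_cat.
by move=> /derivable_slice; rewrite -partials_slice.
Qed.

Lemma continuous_box_within n (a b : 'rV[R]_n) (g : 'rV[R]_n -> R) :
  (forall x, box a b x -> {for x, continuous g}) -> {within box a b, continuous g}.
Proof. by move=> cg; apply: continuous_in_subspaceT => x /[!inE] /cg. Qed.

(** Induction on the dimension. Let [G] be the derivative of [f] in all directions
but the first. By the induction hypothesis on the slices of [f], the vertex sums
of the two faces orthogonal to the first direction are integrals of [G] over
these faces; their difference is the integral over a face of the increments of
[G] along the first direction, each of which is the integral of the full mixed
derivative over a segment. *)
Lemma ftc_box n (f : 'rV[R]_n -> R) (p q : 'rV[R]_n) :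
  (forall i, p 0 i <= q 0 i) ->
  smooth_along (enum 'I_n) (box p q) f ->
  (\int[lebesgue_rV n]_(x in box p q) (partials (enum 'I_n) f x)%:E =
   (alt_vertex_sum f (p, q))%:E)%E.
Proof.
elim: n f p q => [|n IH] f p q pq sf.
  have -> : f = cst (f 0) by apply/funext => x; congr f; apply/rowP => -[].
  rewrite enum_ord0 /= integral_cst; last exact: measurable_box.
  have B1 : lebesgue_rV 0 (box p q) = 1%E by rewrite lebesgue_rV_box// big_ord0.
  rewrite [X in (_ * X)%E]B1 mule1 /alt_vertex_sum.
  under eq_bigr do rewrite big_ord0 expr0 mul1r.
  by rewrite sumr_const card_ffun card_ord expn0.
have pq' i : col' ord0 p 0 i <= col' ord0 q 0 i by rewrite !mxE.
have [cf df] := sf.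
set G := partials (map (lift ord0) (enum 'I_n)) f.
have GE : partials (enum 'I_n.+1) f = 'D_(delta_mx 0 ord0) G.
  by rewrite enum_ordSl.
have IHt t : t \in `[p 0 ord0, q 0 ord0] ->
  (\int[lebesgue_rV n]_(w in box (col' ord0 p) (col' ord0 q)) (G (ins ord0 w t))%:E =
  (alt_vertex_sum (fun w => f (ins ord0 w t)) (col' ord0 p, col' ord0 q))%:E)%E.
  move=> tpq; rewrite -IH//; last exact: smooth_along_slice.
  by rewrite -partials_slice.
have p_pq : p 0 ord0 \in `[p 0 ord0, q 0 ord0] by rewrite in_itv/= lexx pq.
have q_pq : q 0 ord0 \in `[p 0 ord0, q 0 ord0] by rewrite in_itv/= lexx pq.
have iG t : t \in `[p 0 ord0, q 0 ord0] ->
    (lebesgue_rV n).-integrable (box (col' ord0 p) (col' ord0 q))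
      (EFin \o (fun w => G (ins ord0 w t))).
  move=> tpq; apply: continuous_box_integrable; apply: continuous_box_within => w Bw.
  apply: continuous_comp; first exact: continuous_slice.
  apply: (cf [:: ord0]); first by rewrite enum_ordSl.
  exact/box_ins.
rewrite alt_vertex_sum_ins0 EFinB -!IHt// -integralB//; try exact: iG; last first.
  exact: measurable_box.
rewrite (integral_box_insr ord0); last first.
  apply: continuous_box_integrable; apply: continuous_box_within => w Bw.
  by apply: (cf [::]).
apply: eq_integral => w /[!inE] Bw; rewrite -EFinB.
apply: (@ftc_segment (fun t => G (ins ord0 w t))
  (fun t => partials (enum 'I_n.+1) f (ins ord0 w t))) => // t tpq.
  have Bx : box p q (ins ord0 w t) by exact/box_ins.
  split.
  - apply: derivable_line; apply: (df [::]); first by rewrite enum_ordSl.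
    exact: Bx.
  - by rewrite GE -derive_line.
  - apply: continuous_comp; first exact: continuous_line.
    by apply: (cf [::]).
Qed.
End ftc.

(** * Interior, faces and homotheties of a box *)

Section box_geometry.
Context {R : realType} {n : nat}.
Implicit Types (a b c p q x : 'rV[R]_n).

Definition open_box a b : set 'rV[R]_n :=
  [set x | forall i, x 0 i \in `]a 0 i, b 0 i[].

Lemma open_box_sub a b : open_box a b `<=` box a b.
Proof. by move=> x h i; apply: subset_itv_oo_cc; exact: h. Qed.

Lemma cvg_rV (F : set_system nat) {FF : Filter F} (u : nat -> 'rV[R]_n) x :
  (forall i, u k 0 i @[k --> F] --> x 0 i) -> u k @[k --> F] --> x.
Proof.
move=> ux; apply/cvg_ballP => e e0.
have h i : \forall k \near F, `|x 0 i - u k 0 i| < e.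
  by move/cvgr_dist_lt : (ux i); exact.
near=> k; apply/rV_ballP => //; near: k; exact: filter_forall.
Unshelve. all: by end_near. Qed.

Lemma open_open_box a b : open (open_box a b).
Proof.
rewrite openE => x abx; apply/nbhs_ballP.
have /choice[e eP] i : exists e : R,
    0 < e /\ forall y, `|x 0 i - y| < e -> y \in `]a 0 i, b 0 i[.
  have : nbhs (x 0 i) [set` `]a 0 i, b 0 i[].
    by apply: open_nbhs_nbhs; split; [exact: interval_open|exact: abx].
  by move=> /nbhs_ballP[e /= e0 eP]; exists e; split=> // y; exact: eP.
exists (\big[Num.min/1]_i e i) => /=.
  by apply: lt_bigmin => // i _; case: (eP i).
have e0 : 0 < \big[Num.min/1]_i e i by apply: lt_bigmin => // i _; case: (eP i).
move=> y /(rV_ballP _ _ e0) xy i; apply: (eP i).2.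
by apply: lt_le_trans (xy i) _; exact: bigmin_le_cond.
Qed.

Lemma interior_box a b : (box a b)° = open_box a b.
Proof.
apply/seteqP; split=> x; last first.
  have sub : open_box a b `<=` (box a b)°.
    by rewrite -open_subsetE; [exact: open_box_sub|exact: open_open_box].
  exact: sub.
move=> /nbhs_ballP[e /= e0 eB] i; rewrite in_itv/=.
have xe (s : R) : `|s| < e -> x 0 i + s \in `[a 0 i, b 0 i].
  move=> se; have := eB (\row_j (x 0 j + (j == i)%:R * s)).
  have /[swap]/[apply] : ball x e (\row_j (x 0 j + (j == i)%:R * s)).
    apply/rV_ballP => // j; rewrite !mxE opprD addNKr normrN.
    by case: eqP => _; rewrite ?mul1r// mul0r normr0.
  by move=> /(_ i); rewrite !mxE eqxx mul1r.
have e2 : `|e / 2| < e by rewrite gtr0_norm ?divr_gt0// ltr_pdivrMr// ltr_pMr// ltr1n.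
have := xe _ e2; have := xe (- (e / 2)); rewrite normrN => /(_ e2).
rewrite !in_itv/= => /andP[h1 _] /andP[_ h2].
have e20 : 0 < e / 2 by rewrite divr_gt0.
by apply/andP; split; [apply: le_lt_trans h1 _; rewrite ltrBlDr ltrDl
  |apply: lt_le_trans _ h2; rewrite ltrDl].
Qed.

Lemma ae_coord_neq (i : 'I_n) (r : R) :
  {ae lebesgue_rV n, forall x : 'rV[R]_n, x 0 i <> r}.
Proof.
exists [set x : 'rV[R]_n | x 0 i = r]; split.
- rewrite -[X in measurable X]setTI.
  exact: (@measurable_rV_coord _ R n i measurableT [set r]).
- exact: lebesgue_rV_hyperplane.
- by move=> x /= /contrapT.
Qed.

(** The faces of a box lie on finitely many hyperplanes. *)
Lemma ae_open_box a b :
  {ae lebesgue_rV n, forall x, box a b x -> open_box a b x}.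
Proof.
have FF := ae_filter_ringOfSetsType (@lebesgue_rV R n).
have h1 := filter_forall FF (fun i => ae_coord_neq i (a 0 i)).
have h2 := filter_forall FF (fun i => ae_coord_neq i (b 0 i)).
apply: filterS2 h1 h2 => x xa xb abx i.
move: (abx i) (xa i) (xb i); rewrite !in_itv/= !le_eqVlt.
by move=> /andP[/orP[/eqP->//|->] /orP[/eqP->//|->]].
Qed.

(** The homothety of centre [c] and ratio [1 - 1/(k+1)]. When [c] is interior to a
box, it maps the closed box into the open one, and it tends to the identity. *)
Definition shrink c (k : nat) p : 'rV[R]_n := p + k.+1%:R^-1 *: (c - p).

Lemma cvg_shrink c p : shrink c k p @[k --> \oo] --> p.
Proof.
apply: cvg_rV => i; rewrite /shrink.
under eq_fun do rewrite !mxE.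
have := cvgD (cvg_cst (p 0 i)) (cvgMr_tmp (b := c 0 i - p 0 i) (@cvg_harmonic R)).
by rewrite mul0r addr0; exact.
Qed.

Lemma le_shrink c k p q : (forall i, p 0 i <= q 0 i) ->
  forall i, shrink c k p 0 i <= shrink c k q 0 i.
Proof.
move=> pq i; rewrite !mxE -subr_ge0.
rewrite (_ : _ - _ = (1 - k.+1%:R^-1) * (q 0 i - p 0 i)); last by ring.
by rewrite mulr_ge0 ?subr_ge0// invf_le1// ler1n.
Qed.

Lemma shrink_open_box a b c k p : open_box a b c -> box a b p ->
  open_box a b (shrink c k p).
Proof.
move=> abc abp i; have := abc i; have := abp i.
rewrite !in_itv/= !mxE => /andP[ap pb] /andP[ac cb].
set s := k.+1%:R^-1; have s0 : 0 < s by rewrite invr_gt0.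
have s1 : s <= 1 by rewrite invf_le1// ler1n.
by apply/andP; split; nra.
Qed.

Lemma closure_interior_box a b x : (forall i, a 0 i < b 0 i) ->
  box a b x -> closure (box a b)° x.
Proof.
move=> ab abx B Bx; pose c : 'rV[R]_n := \row_i ((a 0 i + b 0 i) / 2).
have abc : open_box a b c.
  by move=> i; rewrite in_itv/= mxE; have := ab i => abi; apply/andP; split; lra.
have [k _ /(_ k (leqnn _)) Bk] := cvg_shrink c Bx.
exists (shrink c k x); split => //; rewrite interior_box.
exact: shrink_open_box.
Qed.

End box_geometry.

(** * The fundamental theorem of calculus up to the boundary *)

Section smooth_up_to_boundary.
Context {R : realType} {n : nat}.
Variables (a b : 'rV[R]_n) (f : 'rV[R]_n -> R).
Hypothesis ab : forall i, a 0 i < b 0 i.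
Hypothesis Sf : Ck_upto_bdry n (box a b) f.
Let S := box a b.

(** In the interior each partial derivative coincides with a function continuous on
the closed box, hence is continuous there. *)
Lemma Ck_smooth_along (B : set 'rV[R]_n) : B `<=` S° ->
  smooth_along (enum 'I_n) B f.
Proof.
move=> BS; have [_ Sf'] := Sf.
have sz : size (enum 'I_n) = n by rewrite -cardE card_ord.
split=> [t r tr x /BS Sx|t k r tr x /BS Sx].
  have [|_ [g cg gE]] := Sf' r.
    by rewrite -[leqRHS]sz tr size_cat leq_addl.
  have cgx : g @ x --> g x.
    have /subspace_continuousP/(_ x (interior_subset Sx)) := cg.
    by rewrite within_interior.
  rewrite /prop_for /continuous_at (gE _ Sx) => U /cgx; rewrite !nbhs_simpl /=.
  have /filterS2 : nbhs x S°.
    by apply: open_nbhs_nbhs; split => //; exact: open_interior.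
  by apply => y Sy; rewrite /preimage /= gE.
have [|+ _] := Sf' r.
  by rewrite -[leqRHS]sz tr size_cat/= (leq_trans (leqnSn _))// leq_addl.
by apply => //; rewrite -[ltnRHS]sz tr size_cat/= ltn_addl.
Qed.

Lemma vertex_in_box p q (nu : {ffun 'I_n -> bool}) : S p -> S q ->
  S (\row_i (q 0 i + (nu i)%:R * (p 0 i - q 0 i))).
Proof.
move=> Sp Sq i; rewrite mxE; case: (nu i); rewrite ?mul1r ?mul0r ?addr0 //.
by rewrite addrC subrK.
Qed.

Lemma cvg_coord (u : nat -> 'rV[R]_n) (l : 'rV[R]_n) i :
  u @ \oo --> l -> u k 0 i @[k --> \oo] --> l 0 i.
Proof.
move=> ul; apply: (@cvg_comp _ _ _ u (fun M : 'rV[R]_n => M 0 i) _ _ _ ul).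
exact: coord_continuous.
Qed.

Lemma cvg_alt_vertex_sum (p_ q_ : nat -> 'rV[R]_n) p q :
  S p -> S q -> (forall k, S (p_ k)) -> (forall k, S (q_ k)) ->
  p_ @ \oo --> p -> q_ @ \oo --> q ->
  alt_vertex_sum f (p_ k, q_ k) @[k --> \oo] --> alt_vertex_sum f (p, q).
Proof.
move=> Sp Sq Sp_ Sq_ cp cq; rewrite /alt_vertex_sum /=.
apply: cvg_big => [|nu _]; first exact: add_continuous.
apply: cvgMl_tmp; have [/subspace_continuousP cf _] := Sf.
apply: cvg_comp (cf _ (vertex_in_box nu Sp Sq)).
pose v_ k : 'rV[R]_n := \row_i (q_ k 0 i + (nu i)%:R * (p_ k 0 i - q_ k 0 i)).
have cv : v_ k @[k --> \oo] -->
    (\row_i (q 0 i + (nu i)%:R * (p 0 i - q 0 i)) : 'rV[R]_n).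
  apply: cvg_rV => i; rewrite mxE /v_; under eq_fun do rewrite mxE.
  apply: cvgD; first exact: cvg_coord.
  by apply: cvgMl_tmp; apply: cvgB; exact: cvg_coord.
move=> U /= /cv SU; suff : \forall k \near \oo, U (v_ k) by [].
apply: filterS (SU : \forall k \near \oo, S (v_ k) -> U (v_ k)) => k; apply.
exact: vertex_in_box.
Qed.

Variable g : 'rV[R]_n -> R.
Hypothesis cg : {within S, continuous g}.
Hypothesis gE : forall x, S° x -> partials (enum 'I_n) f x = g x.

Lemma mixed_partialE x : S x -> mixed_partial S f x = g x.
Proof.
move=> Sx; rewrite /mixed_partial /bdry_ext.
have PF : ProperFilter (within S° (nbhs x)).
  by apply: within_nbhs_proper; exact: closure_interior_box.
apply: cvg_lim => //.
have cgx : g @ within S° (nbhs x) --> g x.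
  move/subspace_continuousP : cg => /(_ x Sx); apply: cvg_trans.
  apply: cvg_app; apply: within_subset; exact: interior_subset.
apply: cvg_trans cgx; apply: fmap_within_eq => y /[!inE] Sy.
by rewrite gE.
Qed.

Lemma box_sub p q : S p -> S q -> box p q `<=` S.
Proof.
move=> Sp Sq x pqx i; move: (Sp i) (Sq i) (pqx i); rewrite !in_itv/=.
move=> /andP[ap _] /andP[_ qb] /andP[px xq].
by rewrite (le_trans ap px) (le_trans xq qb).
Qed.

Lemma open_box_sub_open p q : open_box a b p -> open_box a b q ->
  box p q `<=` open_box a b.
Proof.
move=> Sp Sq x pqx i; move: (Sp i) (Sq i) (pqx i); rewrite !in_itv/=.
move=> /andP[ap _] /andP[_ qb] /andP[px xq].
by rewrite (lt_le_trans ap px) (le_lt_trans xq qb).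
Qed.

(** The images of [p] and [q] under [shrink] span boxes in the interior of [S],
where [ftc_box] applies. Along them the vertex sums converge because [f] is
continuous on the closed box, and the integrals by dominated convergence: the
indicators converge off the faces of [box p q]. *)
Lemma ftc_closed_box p q : S p -> S q -> (forall i, p 0 i <= q 0 i) ->
  (\int[lebesgue_rV n]_(x in box p q) (g x)%:E = (alt_vertex_sum f (p, q))%:E)%E.
Proof.
move=> Sp Sq pq; pose c : 'rV[R]_n := \row_i ((a 0 i + b 0 i) / 2).
have abc : open_box a b c.
  by move=> i; rewrite in_itv/= mxE; have := ab i => abi; apply/andP; split; lra.
pose p_ k := shrink c k p; pose q_ k := shrink c k q.
have op k : open_box a b (p_ k) by exact: shrink_open_box.
have oq k : open_box a b (q_ k) by exact: shrink_open_box.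
have cp : p_ @ \oo --> p by exact: cvg_shrink.
have cq : q_ @ \oo --> q by exact: cvg_shrink.
have mS : measurable S by exact: measurable_box.
have inner k : (\int[lebesgue_rV n]_(x in S) ((EFin \o g) \_ (box (p_ k) (q_ k))) x =
    (alt_vertex_sum f (p_ k, q_ k))%:E)%E.
  have sub : box (p_ k) (q_ k) `<=` S°.
    by rewrite interior_box; exact: open_box_sub_open.
  rewrite -ftc_box; [|exact: le_shrink|exact: Ck_smooth_along].
  rewrite -integral_mkcondr setIidr; last first.
    exact: subset_trans sub (@interior_subset _ _).
  by apply: eq_integral => x /[!inE] /sub /gE ->.
have ig : (lebesgue_rV n).-integrable S (EFin \o g) by exact: continuous_box_integrable.
have mg B : measurable B -> measurable_fun S ((EFin \o g) \_ B).
  move=> mB; apply/(measurable_restrict _ mB mS).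
  by apply: measurable_funS (measurable_int _ ig) => //; exact: subIsetl.
have near_coord (u : nat -> 'rV[R]_n) (l x : 'rV[R]_n) (i : 'I_n) :
    u @ \oo --> l ->
    (l 0 i < x 0 i -> \forall k \near \oo, u k 0 i < x 0 i) /\
    (x 0 i < l 0 i -> \forall k \near \oo, x 0 i < u k 0 i).
  move=> ul; have uli : u k 0 i @[k --> \oo] --> l 0 i.
    exact: cvg_coord.
  by split=> [/(cvgr_lt _ uli)|/(cvgr_gt _ uli)].
pose F k := (EFin \o g) \_ (box (p_ k) (q_ k)).
have Fcvg : {ae lebesgue_rV n, forall x, S x ->
    F ^~ x @ \oo --> ((EFin \o g) \_ (box p q)) x}.
  have FF := ae_filter_ringOfSetsType (@lebesgue_rV R n).
  apply: filterS (ae_open_box p q) => x pqx Sx.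
  apply: cvg_near_cst; have [xpq|xpq] := pselect (box p q x).
    have h : \forall k \near \oo, forall i, p_ k 0 i < x 0 i < q_ k 0 i.
      apply: filter_forall => i.
      have := pqx xpq i; rewrite in_itv/= => /andP[px xq].
      near=> k; apply/andP; split; near: k.
        by apply (near_coord _ _ _ _ cp).1.
      by apply (near_coord _ _ _ _ cq).2.
    apply: filterS h => k h; rewrite /F !patchE !mem_set//.
    by move=> i; rewrite in_itv/=; have /andP[/ltW -> /ltW ->] := h i.
  have [i xi] : exists i, x 0 i < p 0 i \/ q 0 i < x 0 i.
    apply: contra_notP xpq => h i; rewrite in_itv/= !leNgt.
    by apply/andP; split; apply/negP => hi; apply: h; exists i; [left|right].
  have h : \forall k \near \oo, x 0 i < p_ k 0 i \/ q_ k 0 i < x 0 i.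
    case: xi => [/(near_coord _ _ _ _ cp).2|/(near_coord _ _ _ _ cq).1];
      by apply: filterS => k hk; tauto.
  apply: filterS h => k h; rewrite /F !patchE !memNset//.
  move=> /(_ i); rewrite in_itv/= !leNgt => /andP[/negP xp /negP qx].
  by case: h.
have Fdom : {ae lebesgue_rV n, forall x k, S x ->
    (`|F k x| <= (abse \o (EFin \o g)) x)%E}.
  apply: aeW => x k Sx; rewrite /F patchE; case: ifP => //= _.
  by rewrite normr0 lee_fin.
have [_ _ lim1] := @dominated_convergence _ _ _ (lebesgue_rV n) S mS
  F ((EFin \o g) \_ (box p q)) (abse \o (EFin \o g))
  (fun k => mg _ (measurable_box _ _)) (mg _ (measurable_box p q))
  Fcvg (integrable_abse ig)
  Fdom.
have lim2 : (alt_vertex_sum f (p_ k, q_ k))%:E @[k --> \oo] -->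
    (alt_vertex_sum f (p, q))%:E.
  apply: cvg_EFin; first exact: nearW.
  by apply: cvg_alt_vertex_sum => // k; exact: open_box_sub.
have seqE : (fun k => (alt_vertex_sum f (p_ k, q_ k))%:E) =
    (fun k => \int[lebesgue_rV n]_(x in S) F k x)%E.
  by apply/funext => k; rewrite -inner.
rewrite seqE in lim2.
have := cvg_unique _ lim1 lim2; rewrite -integral_mkcondr setIidr; first exact.
exact: box_sub.
Unshelve. all: by end_near. Qed.

End smooth_up_to_boundary.

(** * The iterated tail integral is an integral over a box *)

Section almost_everywhere_integral.
Context d (T : measurableType d) (R : realType).
Variable mu : {measure set T -> \bar R}.
Local Open Scope ereal_scope.
Import HBNNSimple.

(** A simple function below [f] keeps its integral when it is set to 0 on a null
set, and is then below [g]. *)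
Lemma ge0_ae_le_integralT (f g : T -> \bar R) :
  (forall x, 0 <= f x) -> (forall x, 0 <= g x) ->
  {ae mu, forall x, f x <= g x} -> \int[mu]_x f x <= \int[mu]_x g x.
Proof.
move=> f0 g0 [N [mN N0 fgN]]; rewrite !ge0_integralTE//.
apply: ge_ereal_sup => _ [h hf <-].
have mNC : measurable (~` N) by exact: measurableC.
pose k := proj_nnsfun h mNC.
have -> : sintegral mu h = sintegral mu k.
  rewrite -!integralT_nnsfun; apply: ae_eq_integral => //.
    exact/measurable_EFinP.
    exact/measurable_EFinP.
  exists N; split => // x /= hk; apply: contrapT => Nx; apply: hk => _.
  by rewrite /= mindicE mem_set// mulr1.
apply: ereal_sup_ubound; exists k => // x /=; rewrite mindicE.
have [Nx|Nx] := pselect (N x); first by rewrite memNset ?mulr0.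
rewrite mem_set// mulr1; apply: le_trans (hf x) _.
by apply: contrapT => hx; apply: Nx; exact: fgN.
Qed.

(** For iterated integrals: the inner one has no meaningful value on the null set of
sections that are not integrable, and need not be measurable in the outer
variable. *)
Lemma ae_eq_integral_patch (D : set T) (f g : T -> \bar R) :
  {ae mu, forall x, D x -> f x = g x} ->
  \int[mu]_(x in D) f x = \int[mu]_(x in D) g x.
Proof.
move=> fg; rewrite integral_mkcond [RHS]integral_mkcond.
have {}fg : {ae mu, forall x, (f \_ D) x = (g \_ D) x}.
  apply: filterS fg => x fg; rewrite !patchE; case: ifPn => // /[!inE]; exact: fg.
rewrite integralE [RHS]integralE; congr (_ - _); apply/eqP; rewrite eq_le;
  apply/andP; split; apply: ge0_ae_le_integralT => //;
  by apply: filterS fg => x fg; rewrite ?funeposE ?funenegE fg.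
Qed.

End almost_everywhere_integral.

Section iterated_tail_integral.
Context {R : realType}.

Lemma ins_col'E n (i : 'I_n) (x : 'rV[R]_n) s :
  ins i (col' i x) s = \row_j (if j == i then s else x 0 j).
Proof.
apply/rowP => j; rewrite !mxE; case: unliftP => [k ->|->]; last by rewrite eqxx.
by rewrite (eq_sym _ i) (negbTE (neq_lift _ _)) !mxE.
Qed.

Lemma tail_int1_slice n (b : 'rV[R]_n.+1) (k : 'I_n) (phi : 'rV[R]_n.+1 -> R) t :
  (fun w => tail_int1 b (lift ord0 k) phi (ins ord0 w t)) =
  tail_int1 (col' ord0 b) k (fun w => phi (ins ord0 w t)).
Proof.
apply/funext => w; rewrite /tail_int1 (@ins_lift _ n) mxE.
congr (Rintegral _ _ _); apply/funext => s; congr phi.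
apply/rowP => j; rewrite !ins_col'E !mxE.
case: (unliftP ord0 j) => [l ->|->]; first by rewrite (inj_eq lift_inj) !mxE.
by rewrite -(inj_eq val_inj).
Qed.

Lemma tail_int_slice n (b : 'rV[R]_n.+1) (s : seq 'I_n) (phi : 'rV[R]_n.+1 -> R) t :
  (fun w => foldr (tail_int1 b) phi (map (lift ord0) s) (ins ord0 w t)) =
  foldr (tail_int1 (col' ord0 b)) (fun w => phi (ins ord0 w t)) s.
Proof. by elim: s => //= k s IH; rewrite tail_int1_slice IH. Qed.

(** [foldr] over the enumeration of the coordinates makes coordinate 0 the outermost
integral, like the recursion that defines the measure; Fubini therefore applies
one coordinate at a time. *)
Lemma tail_int_box n (b w : 'rV[R]_n) (phi : 'rV[R]_n -> R) :
  (lebesgue_rV n).-integrable (box w b) (EFin \o phi) ->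
  tail_int b phi w = \int[lebesgue_rV n]_(x in box w b) phi x.
Proof.
elim: n b w phi => [|n IH] b w phi iphi.
  have -> : phi = cst (phi w) by apply/funext => x; congr phi; apply/rowP => -[].
  rewrite /tail_int enum_ord0 /= /Rintegral integral_cst; last exact: measurable_box.
  have B1 : lebesgue_rV 0 (box w b) = 1%E by rewrite lebesgue_rV_box ?big_ord0// => -[].
  by rewrite [X in (_ * X)%E]B1 mule1.
rewrite /tail_int enum_ordSl /= /tail_int1 /Rintegral (integral_box_ins ord0)//.
congr fine; apply: ae_eq_integral_patch.
apply: filterS (ae_integrable_box_ins ord0 iphi) => t it tI.
have := congr1 (fun h => h (col' ord0 w)) (tail_int_slice b (enum 'I_n) phi t).
move=> /= ->; rewrite -/(tail_int _ _) IH; last exact: it.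
by rewrite fineK//; apply: integrable_fin_num; [exact: measurable_box|exact: it].
Qed.

End iterated_tail_integral.

(** * Cancellation for centered functions *)

Section centering.
Context {R : realType}.

Lemma integrableM_bounded d (T : measurableType d) (mu : {measure set T -> \bar R})
    (D : set T) (phi h : T -> R) M : measurable D ->
  mu.-integrable D (EFin \o phi) -> measurable_fun D h ->
  (forall x, D x -> `|h x| <= M) ->
  mu.-integrable D (EFin \o (fun x => phi x * h x)).
Proof.
move=> mD iphi mh hM.
have bh : [bounded h x | x in D].
  exists M; split; first exact: num_real.
  by move=> y My x Dx; apply: le_trans (hM x Dx) (ltW My).
by have := integrableMl mD iphi mh bh; apply: eq_integrable => // x _; rewrite /= EFinM.
Qed.

Definition agree_off n (i : 'I_n) (x y : 'rV[R]_n) := forall j, j != i -> x 0 j = y 0 j.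

(** On almost every line in direction [i], [h] is constant and [phi] has integral 0. *)
Lemma centered_integral_eq0 n (a b : 'rV[R]_n) (i : 'I_n) (phi h : 'rV[R]_n -> R) :
  centered a b phi ->
  (lebesgue_rV n).-integrable (box a b) (EFin \o phi) ->
  (lebesgue_rV n).-integrable (box a b) (EFin \o (fun x => phi x * h x)) ->
  (forall x y, agree_off i x y -> h x = h y) ->
  (\int[lebesgue_rV n]_(x in box a b) (phi x * h x)%:E = 0)%E.
Proof.
case: n i a b phi h => [[]//|n] i a b phi h cphi iphi iphih hi.
rewrite (integral_box_insr i)//.
rewrite -[RHS](@integral0 _ _ _ (lebesgue_rV n) (box (col' i a) (col' i b))).
apply: ae_eq_integral_patch.
apply: filterS2 (cphi i) (ae_integrable_box_insr i iphi) => w cw iw Bw.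
under eq_integral => t _.
  rewrite (hi _ (ins i w 0)); last first.
    move=> j ji; rewrite !mxE; case: unliftP => // ij.
    by rewrite ij eqxx in ji.
  rewrite EFinM.
  over.
by rewrite /= integralZr//; [rewrite cw// mul0e|exact: iw].
Qed.

(** A nonempty [nu] contains a coordinate on which [h nu] does not depend, so its
term vanishes. *)
Lemma centered_integral_sum n (a b : 'rV[R]_n) (phi : 'rV[R]_n -> R)
    (h : {ffun 'I_n -> bool} -> 'rV[R]_n -> R) :
  centered a b phi ->
  (lebesgue_rV n).-integrable (box a b) (EFin \o phi) ->
  (forall nu, measurable_fun (box a b) (h nu)) ->
  (forall nu, exists M : R, forall x, box a b x -> `|h nu x| <= M) ->
  (forall (nu : {ffun 'I_n -> bool}) i, nu i ->
     forall x y, agree_off i x y -> h nu x = h nu y) ->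
  (\int[lebesgue_rV n]_(x in box a b) (phi x * \sum_nu h nu x)%:E =
   \int[lebesgue_rV n]_(x in box a b) (phi x * h [ffun=> false] x)%:E)%E.
Proof.
move=> cphi iphi mh bh hi; have mB := measurable_box a b.
have ih nu : (lebesgue_rV n).-integrable (box a b)
    (EFin \o (fun x => phi x * h nu x)).
  by have [M] := bh nu; exact: integrableM_bounded.
under eq_integral => x _.
  rewrite mulr_sumr -sumEFin.
  over.
rewrite integral_sum//= (bigD1 [ffun=> false])//= big1 ?adde0// => nu nu0.
have [i nui] : exists i, nu i.
  apply/existsP; apply: contraR nu0 => /existsPn nu0; apply/eqP/ffunP => i.
  by rewrite ffunE; apply/negbTE/nu0.
exact: (centered_integral_eq0 cphi iphi (ih nu) (hi nu i nui)).
Qed.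

Lemma tail_boxE n (a b w x : 'rV[R]_n) : box a b w ->
  box w b x <-> box a b x /\ forall i, w 0 i <= x 0 i.
Proof.
move=> abw; split=> [wbx|[abx wx] i].
  split=> i; have := wbx i; have := abw i; rewrite !in_itv/=.
    by move=> /andP[aw _] /andP[wx ->]; rewrite (le_trans aw wx).
  by move=> _ /andP[].
by have := abx i; rewrite !in_itv/= => /andP[_ ->]; rewrite wx.
Qed.

Lemma measurable_halfspace n (i : 'I_n) (c : R) :
  measurable [set x : 'rV[R]_n | c <= x 0 i].
Proof.
have := @measurable_rV_coord _ R n i measurableT _ (measurable_itv `[c, +oo[).
rewrite setTI; congr measurable; apply/seteqP; split=> x /=;
  by rewrite in_itv/= andbT.
Qed.

Lemma indic_tail_box n (a b w x : 'rV[R]_n) : box a b w -> box a b x ->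
  \1_(box w b) x = \prod_i \1_[set y : 'rV[R]_n | w 0 i <= y 0 i] x :> R.
Proof.
move=> abw abx; rewrite indicE; have [wbx|wbx] := pselect (box w b x).
  rewrite mem_set// big1// => i _; rewrite indicE mem_set//=.
  exact: ((tail_boxE x abw).1 wbx).2.
rewrite memNset//; have [i wxi] : exists i, ~ (w 0 i <= x 0 i).
  by apply/existsNP; apply: contra_not wbx => wx; apply/(tail_boxE x abw).
by rewrite (bigD1 i)//= indicE memNset// mul0r.
Qed.

(** The indicator of the tail box is the term of the empty subset in the expansion
of the product of the functions [1_{w_i <= t_i} - 1/2]; the other terms do not
depend on some coordinate. Every factor has absolute value [1/2]. *)
Lemma centered_tail_bound n (a b w : 'rV[R]_n) (phi : 'rV[R]_n -> R) :
  centered a b phi ->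
  (lebesgue_rV n).-integrable (box a b) (EFin \o phi) -> box a b w ->
  (`|\int[lebesgue_rV n]_(x in box w b) (phi x)%:E| <=
   (2 ^- n)%:E * \int[lebesgue_rV n]_(x in box a b) `|phi x|%:E)%E.
Proof.
move=> cphi iphi abw.
have mB := measurable_box a b; have mw := measurable_box w b.
pose half i (x : 'rV[R]_n) : R := \1_[set y : 'rV[R]_n | w 0 i <= y 0 i] x.
pose h (nu : {ffun 'I_n -> bool}) x : R :=
  \prod_i (if nu i then - 2^-1 else half i x).
have half_le i x : 0 <= half i x <= 1.
  by rewrite /half indicE; case: (_ \in _); rewrite ?lexx ler01.
have mh nu : measurable_fun (box a b) (h nu).
  apply: measurable_prod => i _; case: (nu i) => //.
  by apply: measurable_funTS; apply: measurable_indic; exact: measurable_halfspace.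
have bh nu : exists M : R, forall x, box a b x -> `|h nu x| <= M.
  exists 1 => x _; rewrite normr_prod; apply: prodr_ile1 => i _.
  rewrite normr_ge0; case: (nu i); last first.
    by have /andP[h0 h1] := half_le i x; rewrite ger0_norm.
  by rewrite normrN ger0_norm ?invr_ge0// invf_le1// ler1n.
have hi (nu : {ffun 'I_n -> bool}) i : nu i ->
    forall x y, agree_off i x y -> h nu x = h nu y.
  move=> nui x y xy; apply: eq_bigr => j _; have [->|ji] := eqVneq j i.
    by rewrite nui.
  rewrite /half !indicE (_ : (x \in _) = (y \in [set z : 'rV[R]_n | w 0 j <= z 0 j]))//.
  by apply/idP/idP; rewrite !inE/= xy.
have hsum x : \sum_nu h nu x = \prod_i (half i x - 2^-1).
  rewrite -(bigA_distr_bigA (fun i (c : bool) => if c then - 2^-1 else half i x)).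
  by apply: eq_bigr => i _; rewrite big_bool/= addrC.
have -> : (\int[lebesgue_rV n]_(x in box w b) (phi x)%:E =
    \int[lebesgue_rV n]_(x in box a b) (phi x * \prod_i (half i x - 2^-1))%:E)%E.
  under [RHS]eq_integral do rewrite -hsum.
  rewrite centered_integral_sum//.
  have -> : box w b = box a b `&` box w b.
    by rewrite setIidr// => x /(tail_boxE x abw)[].
  rewrite integral_mkcondr; apply: eq_integral => x /[!inE] abx.
  rewrite patchE /h (_ : \prod_i _ = \1_(box w b) x); last first.
    by rewrite (indic_tail_box abw)//; apply: eq_bigr => i _; rewrite ffunE.
  by rewrite indicE; case: ifP => _; rewrite ?mulr1 ?mulr0.
have Pn x : `|\prod_i (half i x - 2^-1)| = 2 ^- n.
  rewrite normr_prod (eq_bigr (fun=> 2^-1)) => [|i _].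
    by rewrite prodr_const card_ord exprVn.
  rewrite /half indicE; case: (_ \in _) => /=; last first.
    by rewrite sub0r normrN gtr0_norm ?invr_gt0.
  by rewrite (_ : 1 - 2^-1 = 2^-1 :> R) ?gtr0_norm ?invr_gt0//; lra.
have mP : measurable_fun (box a b) (fun x => \prod_i (half i x - 2^-1)).
  apply: measurable_prod => i _; apply: measurable_funB => //.
  by apply: measurable_funTS; apply: measurable_indic; exact: measurable_halfspace.
apply: le_trans (le_abse_integral _ _ _) _ => //.
  apply/measurable_EFinP; apply: measurable_funM => //.
  by apply/measurable_EFinP; exact: (measurable_int _ iphi).
rewrite -ge0_integralZl//; last first.
  do 2 apply: measurableT_comp => //.
  by apply/measurable_EFinP; exact: (measurable_int _ iphi).
under eq_integral => x _ do rewrite abse_EFin normrM Pn mulrC EFinM.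
by [].
Qed.

End centering.

(** * Exchanging tails and heads of boxes *)

Section tail_duality.
Context {R : realType} {n : nat}.
Local Notation mu := (lebesgue_rV n).
Implicit Types (x t w : 'rV[R]_n).

Lemma head_boxE (a b w x : 'rV[R]_n) : box a b w ->
  box a w x <-> box a b x /\ forall i, x 0 i <= w 0 i.
Proof.
move=> abw; split=> [awx|[abx xw] i].
  split=> i; have := awx i; have := abw i; rewrite !in_itv/=.
    by move=> /andP[_ wb] /andP[-> xw]; rewrite (le_trans xw wb).
  by move=> _ /andP[].
by have := abx i; rewrite !in_itv/= => /andP[-> _]; rewrite xw.
Qed.

Definition le_coord : set ('rV[R]_n * 'rV[R]_n) :=
  [set p : 'rV[R]_n * 'rV[R]_n | forall i, p.2 0 i <= p.1 0 i].

Lemma measurable_le_coord : measurable le_coord.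
Proof.
rewrite (_ : le_coord = \bigcap_(i in [set: 'I_n])
    [set p : 'rV[R]_n * 'rV[R]_n | p.2 0 i <= p.1 0 i]); last first.
  by apply/seteqP; split=> [p h i _|p h i]; exact: h.
apply: fin_bigcap_measurable => // i _.
rewrite -[X in measurable X]setTI.
have mi := @measurable_rV_coord _ R n i.
have m1 := measurableT_comp mi (@measurable_fst _ _ 'rV[R]_n 'rV[R]_n).
have m2 := measurableT_comp mi (@measurable_snd _ _ 'rV[R]_n 'rV[R]_n).
exact: (measurable_fun_le measurableT m2 m1).
Qed.

Section kernel.
Variables (a b : 'rV[R]_n) (phi g : 'rV[R]_n -> R).
Let S := box a b.
Hypothesis iphi : mu.-integrable S (EFin \o phi).
Hypothesis ig : mu.-integrable S (EFin \o g).
Let mS : measurable S. Proof. exact: measurable_box. Qed.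
Let K (p : 'rV[R]_n * 'rV[R]_n) : \bar R :=
  ((phi \_ S) p.1 * (g \_ S) p.2 * \1_le_coord p)%:E.

Let irestr f : mu.-integrable S (EFin \o f) -> mu.-integrable setT (EFin \o (f \_ S)).
Proof. by move=> /(integrable_mkcond _ mS); rewrite restrict_EFin. Qed.

Let mrestr f : mu.-integrable S (EFin \o f) -> measurable_fun setT (f \_ S).
Proof. by move=> /irestr /measurable_int /measurable_EFinP. Qed.

Let iK : (mu \x mu)%E.-integrable setT K.
Proof.
have mK : measurable_fun setT K.
  apply/measurable_EFinP; apply: measurable_funM.
    by apply: measurable_funM; apply: measurableT_comp => //; exact: mrestr.
  exact: measurable_indic measurable_le_coord.
have mAK : measurable_fun setT (abse \o K) by exact: measurableT_comp.
apply/integrable12ltyP => //.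
have /integrableP[mg gfin] := irestr ig.
have /integrableP[mphi phifin] := irestr iphi.
apply: (@le_lt_trans _ _ (\int[mu]_x (`|(EFin \o phi \_ S) x| *
    \int[mu]_y `|(EFin \o g \_ S) y|))%E).
  apply: ge0_le_integral => //.
  - by move=> x _; exact: integral_ge0.
  - apply: (measurable_fun_fubini_tonelli_F (abse \o K)) => // p; exact: abse_ge0.
  - by apply: emeasurable_funM => //; exact: measurableT_comp.
  - move=> x _; rewrite -ge0_integralZl//; last exact: measurableT_comp.
    apply: ge0_le_integral => //.
    + by apply: measurableT_comp => //; exact: (measurableT_comp mK).
    + by apply: emeasurable_funM => //; exact: measurableT_comp.
    + move=> y _; rewrite /K /= lee_fin normrM normrM ler_piMr ?mulr_ge0//.
      by rewrite indicE; case: (_ \in _); rewrite ?normr1 ?normr0.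
rewrite ge0_integralZr//; last 2 first.
  exact: measurableT_comp.
  exact: integral_ge0.
rewrite lte_mul_pinfty//; first exact: integral_ge0.
by rewrite ge0_fin_numE//; exact: integral_ge0.
Qed.

Let KF w : (\int[mu]_t K (w, t))%E =
  ((fun w => (phi w * \int[mu]_(t in box a w) g t)%R%:E) \_ S) w.
Proof.
rewrite patchE; case: ifPn => [/[!inE] Sw|Sw]; last first.
  under eq_integral do rewrite /K patchE (negbTE Sw) mul0r mul0r.
  by rewrite integral0.
have iB : mu.-integrable (box a w) (EFin \o g).
  apply: integrableS ig => //; first exact: measurable_box.
  by move=> x /(head_boxE x Sw)[].
transitivity (\int[mu]_t ((phi w)%:E * ((EFin \o g) \_ (box a w)) t))%E.
  apply: eq_integral => t _; rewrite /K patchE mem_set// patchE [in RHS]patchE indicE.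
  have [awt|awt] := pselect (box a w t).
    have [St tw] := (head_boxE t Sw).1 awt.
    by rewrite mem_set// mem_set// mem_set//= mulr1 EFinM.
  rewrite [in RHS]memNset// mule0; have [St|St] := pselect (S t); last first.
    by rewrite (memNset St) mulr0 mul0r.
  by rewrite (memNset (A := le_coord)) ?mulr0// => tw; apply/awt/(head_boxE t Sw).
rewrite integralZl//; last by apply/(integrable_mkcond _ (measurable_box a w)).
rewrite -integral_mkcond EFinM /Rintegral fineK//.
by apply: integrable_fin_num => //; exact: measurable_box.
Qed.

Let KG t : (\int[mu]_w K (w, t))%E =
  ((fun t => ((\int[mu]_(w in box t b) phi w) * g t)%R%:E) \_ S) t.
Proof.
rewrite patchE; case: ifPn => [/[!inE] St|St]; last first.
  under eq_integral do rewrite /K /= [X in (_ * X * _)%R]patchE (negbTE St) mulr0 mul0r.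
  by rewrite integral0.
have iB : mu.-integrable (box t b) (EFin \o phi).
  apply: integrableS iphi => //; first exact: measurable_box.
  by move=> x /(tail_boxE x St)[].
transitivity (\int[mu]_w (((EFin \o phi) \_ (box t b)) w * (g t)%:E))%E.
  apply: eq_integral => w _.
  rewrite /K patchE patchE [in RHS]patchE indicE (mem_set St).
  have [tbw|tbw] := pselect (box t b w).
    have [Sw tw] := (tail_boxE w St).1 tbw.
    by rewrite mem_set// mem_set// mem_set//= mulr1 EFinM.
  rewrite [in RHS]memNset// mul0e; have [Sw|Sw] := pselect (S w); last first.
    by rewrite (memNset Sw) mul0r mul0r.
  by rewrite (memNset (A := le_coord)) ?mulr0// => tw; apply/tbw/(tail_boxE w St).
rewrite integralZr//; last by apply/(integrable_mkcond _ (measurable_box t b)).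
rewrite -integral_mkcond EFinM /Rintegral fineK//.
by apply: integrable_fin_num => //; exact: measurable_box.
Qed.

(** Both sides are the integral of [phi(w) * g(t)] over the pairs with [t <= w]
coordinatewise, computed in the two orders. *)
Lemma integral_tail_duality :
  (\int[mu]_(w in S) (phi w * \int[mu]_(t in box a w) g t)%R%:E =
   \int[mu]_(t in S) ((\int[mu]_(w in box t b) phi w) * g t)%R%:E)%E.
Proof.
rewrite integral_mkcond [RHS]integral_mkcond.
under eq_integral do rewrite -KF.
under [RHS]eq_integral do rewrite -KG.
exact: Fubini.
Qed.

Lemma measurable_tail_mul : measurable_fun S
  (fun t => ((\int[mu]_(w in box t b) phi w) * g t)%R).
Proof.
apply/measurable_EFinP; rewrite -(setTI S).
apply/(measurable_restrict _ mS measurableT).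
have := measurable_fubini_G iK; congr measurable_fun.
by apply/funext => t; rewrite /fubini_G KG.
Qed.

End kernel.
End tail_duality.

(** * Uniform continuity, partitions and grids *)

Section uniform_continuity.
Context {R : realType} {n : nat}.

(** Near every point of the box some radius works, so by compactness a common one
does. Since [g] is only continuous within the box, all the points compared have
to lie in it. *)
Lemma heine_box (a b : 'rV[R]_n) (g : 'rV[R]_n -> R) (e : R) :
  {within box a b, continuous g} -> 0 < e ->
  exists2 d : R, 0 < d & forall x y, box a b x -> box a b y ->
    (forall i, `|x 0 i - y 0 i| < d) -> `|g x - g y| < e.
Proof.
move=> /subspace_continuousP cg e0.
pose P (d : R) (x : 'rV[R]_n) := box a b x -> forall y, box a b y ->
  ball x d y -> `|g x - g y| < e.
have H := (compact_near_coveringP _).1 (@box_compact _ _ a b) R (0^'+) P _.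
have : \forall d \near 0^'+, box a b `<=` P d.
  apply: H => x abx.
  have e2 : 0 < e / 2 by rewrite divr_gt0.
  have : \forall z \near within (box a b) (nbhs x), `|g x - g z| < e / 2.
    by move/cvgr_dist_lt : (cg x abx); exact.
  rewrite near_withinE => /nbhs_ballP[r /= r0 rP].
  have r2 : 0 < r / 2 by rewrite divr_gt0.
  exists (ball x (r / 2), [set d : R | d < r / 2]).
    split => /=; first exact: nbhsx_ballx.
    exact: nbhs_right_lt.
  move=> [z d] /= [xz dr] abz y aby zy.
  have gz : `|g x - g z| < e / 2.
    apply: rP => //; apply: le_ball xz.
    by rewrite ler_pdivrMr// ler_pMr// ler1n.
  have gy : `|g x - g y| < e / 2.
    apply: rP => //; rewrite (splitr r); apply: ball_triangle xz _.
    by apply: le_ball zy; exact: ltW.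
  rewrite -(subrKA (g x)) (splitr e); apply: le_lt_trans (ler_normD _ _) _.
  by rewrite ltrD// distrC.
move=> /= h; near (0 : R)^'+ => d.
have d0 : 0 < d by near: d; exact: nbhs_right_gt.
have abP : box a b `<=` P d by near: d.
exists d => // x y abx aby xy.
by apply: (abP _ abx abx _ aby); exact/rV_ballP.
Unshelve. all: by end_near. Qed.
End uniform_continuity.

Section box_partition.
Context {R : realType} {n : nat}.
Local Notation mu := (@lebesgue_rV R n).
Implicit Types (S : set 'rV[R]_n) (Q : seq ('rV[R]_n * 'rV[R]_n)).

Lemma box_partition_sub S Q q : is_box_partition S Q -> q \in Q -> box q.1 q.2 `<=` S.
Proof. by move=> [_ _ <-] qQ x qx; exists q. Qed.

Lemma box_lower (p q : 'rV[R]_n) : (forall i, p 0 i <= q 0 i) -> box p q p.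
Proof. by move=> pq i; rewrite in_itv/= lexx pq. Qed.

Lemma box_upper (p q : 'rV[R]_n) : (forall i, p 0 i <= q 0 i) -> box p q q.
Proof. by move=> pq i; rewrite in_itv/= lexx pq. Qed.

(** Off the faces of the cells, a point of [S] lies in exactly one cell, because the
open cells are disjoint. *)
Lemma box_partition_patch S Q (h : 'rV[R]_n -> \bar R) : is_box_partition S Q ->
  {ae mu, forall x, (h \_ S) x = \sum_(q <- Q) (h \_ (box q.1 q.2)) x}%E.
Proof.
move=> [ltQ disjQ coverQ].
have FF := ae_filter_ringOfSetsType mu.
have aeQ := filter_forall FF (fun j : 'I_(size Q) =>
  ae_open_box (nth 0 Q j).1 (nth 0 Q j).2).
apply: filterS aeQ => x openx; rewrite (big_nth 0) big_mkord patchE.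
case: ifPn => [/[!inE]|]; last first.
  rewrite notin_setE -coverQ => nSx; rewrite big1// => j _.
  rewrite patchE memNset// => qx; apply: nSx; exists (nth 0 Q j) => //=.
  by rewrite mem_nth.
rewrite -coverQ => -[q /= qQ qx].
have jQ : (index q Q < size Q)%N by rewrite index_mem.
rewrite (bigD1 (Ordinal jQ))//= nth_index// patchE mem_set// big1 ?adde0// => k kj.
rewrite patchE memNset// => kx.
have ox := openx (Ordinal jQ); rewrite /= nth_index// in ox.
have disj (i j : 'I_(size Q)) : (i < j)%N -> box (nth 0 Q i).1 (nth 0 Q i).2 x ->
    box (nth 0 Q j).1 (nth 0 Q j).2 x -> False.
  move=> ij /openx ix /openx jx; suff : set0 x by [].
  rewrite -(disjQ i j); first by rewrite !interior_box.
  by rewrite ij ltn_ord.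
have qx' : box (nth 0 Q (Ordinal jQ)).1 (nth 0 Q (Ordinal jQ)).2 x.
  by rewrite /= nth_index.
have /orP[h1|h1] : (k < Ordinal jQ)%N || (Ordinal jQ < k)%N by rewrite -neq_ltn.
  exact: disj h1 kx qx'.
exact: disj h1 qx' kx.
Qed.

Lemma box_partition_integral S Q (h : 'rV[R]_n -> \bar R) :
  measurable S -> is_box_partition S Q ->
  measurable_fun S h -> (forall x, 0 <= h x)%E ->
  (\sum_(q <- Q) \int[mu]_(x in box q.1 q.2) h x = \int[mu]_(x in S) h x)%E.
Proof.
move=> mS pQ mh h0; rewrite [RHS]integral_mkcond.
have -> : (\int[mu]_x (h \_ S) x =
    \int[mu]_x \sum_(q <- Q) (h \_ (box q.1 q.2)) x)%E.
  apply: ae_eq_integral_patch; have := box_partition_patch h pQ.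
  have FF := ae_filter_ringOfSetsType mu.
  by apply: filterS => x.
(* Intersecting with [S] makes the functions measurable for all [q], and not
   only for the cells of [Q]. *)
pose F q := h \_ (S `&` box q.1 q.2).
have FE q : q \in Q -> h \_ (box q.1 q.2) = F q.
  by move=> qQ; rewrite /F setIidr//; exact: box_partition_sub pQ qQ.
transitivity (\int[mu]_x \sum_(q <- Q) F q x)%E; last first.
  by apply: eq_integral => x _; apply: eq_big_seq => q qQ; rewrite FE.
rewrite ge0_integral_sum//.
- by apply: eq_big_seq => q qQ; rewrite -FE// -integral_mkcond.
- move=> q; have mq := measurable_box q.1 q.2.
  apply/(measurable_restrict _ (measurableI _ _ mS mq) measurableT).
  by rewrite setTI; apply: measurable_funS mh => //; exact: subIsetl.
- by move=> q x _; rewrite /F patchE; case: ifP.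
Qed.

Lemma box_partition_measure S Q : measurable S -> is_box_partition S Q ->
  (\sum_(q <- Q) mu (box q.1 q.2) = mu S)%E.
Proof.
move=> mS pQ; have := @box_partition_integral S Q (cst 1%E) mS pQ.
rewrite integral_cst// mul1e => <-//.
by apply: eq_bigr => q _; rewrite integral_cst ?mul1e//; exact: measurable_box.
Qed.

End box_partition.

Section grid.
Context {R : realType} {n : nat}.
Variables (a b : 'rV[R]_n) (N : nat).
Hypothesis ab : forall i, a 0 i < b 0 i.
Let step i : R := (b 0 i - a 0 i) / N.+1%:R.
Let step_gt0 i : 0 < step i.
Proof. by rewrite divr_gt0// ?subr_gt0// ltr0n. Qed.

Definition grid_point (k : 'I_n -> nat) : 'rV[R]_n :=
  \row_i (a 0 i + (k i)%:R * ((b 0 i - a 0 i) / N.+1%:R)).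

Definition grid_cell (k : {ffun 'I_n -> 'I_N.+1}) : 'rV[R]_n * 'rV[R]_n :=
  (grid_point (fun i => k i), grid_point (fun i => (k i).+1)).

Definition grid : seq ('rV[R]_n * 'rV[R]_n) :=
  map grid_cell (enum {ffun 'I_n -> 'I_N.+1}).

Lemma grid_cell_width k i :
  (grid_cell k).2 0 i - (grid_cell k).1 0 i = (b 0 i - a 0 i) / N.+1%:R.
Proof. by rewrite !mxE -natr1; ring. Qed.

Lemma grid_cell_sub k : box (grid_cell k).1 (grid_cell k).2 `<=` box a b.
Proof.
move=> x kx i; have := kx i; rewrite !in_itv/= !mxE => /andP[h1 h2].
rewrite -!/(step i) in h1 h2; apply/andP; split.
  by apply: le_trans h1; rewrite lerDl mulr_ge0// ltW.
apply: le_trans h2 _; rewrite -lerBrDl.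
rewrite (_ : b 0 i - a 0 i = N.+1%:R * step i); last first.
  by rewrite /step mulrCA divff ?mulr1// pnatr_eq0.
by rewrite ler_pM2r// ler_nat ltn_ord.
Qed.

Lemma exists_grid_index i t : t \in `[a 0 i, b 0 i] ->
  exists k : 'I_N.+1, a 0 i + k%:R * step i <= t <= a 0 i + k.+1%:R * step i.
Proof.
rewrite in_itv/= => /andP[at_ tb].
(* The least [k] for which the right end of the cell reaches [t]. *)
have ex : exists k, t <= a 0 i + k.+1%:R * step i.
  by exists N; rewrite /step mulrCA divff ?mulr1 ?pnatr_eq0// addrC subrK.
case: (ex_minnP ex) => k tk kmin.
have kN : (k < N.+1)%N.
  rewrite ltnS; apply: kmin.
  by rewrite /step mulrCA divff ?mulr1 ?pnatr_eq0// addrC subrK.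
exists (Ordinal kN); rewrite tk andbT /=.
case: k kmin {tk kN} => [|k] kmin; first by rewrite mul0r addr0.
by rewrite leNgt; apply/negP => /ltW /kmin; rewrite ltnn.
Qed.

Lemma grid_partition : is_box_partition (box a b) grid.
Proof.
split.
- move=> q /mapP[k _ ->] i; rewrite -subr_gt0 grid_cell_width.
  exact: step_gt0.
- move=> j l /andP[jl]; rewrite size_map => lQ.
  have jQ := ltn_trans jl lQ.
  pose k0 : {ffun 'I_n -> 'I_N.+1} := [ffun=> ord0].
  rewrite (nth_map k0 0 grid_cell jQ) (nth_map k0 0 grid_cell lQ) !interior_box.
  set u := nth _ _ j; set v := nth _ _ l.
  have /eqP uv : u != v by rewrite nth_uniq ?enum_uniq// (ltn_eqF jl).
  have [i uvi] : exists i, u i != v i.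
    apply/existsP; apply: contra_notT uv => /existsPn uv.
    by apply/ffunP => i; apply/eqP/negPn/uv.
  have cell_disj (k k' : {ffun 'I_n -> 'I_N.+1}) x : (k i < k' i)%N ->
      open_box (grid_cell k).1 (grid_cell k).2 x ->
      open_box (grid_cell k').1 (grid_cell k').2 x -> False.
    move=> kk' /(_ i) + /(_ i); rewrite !in_itv/= !mxE => /andP[_ h1] /andP[h2 _].
    have := lt_trans h2 h1; rewrite ltrD2l ltr_pM2r; last exact: step_gt0.
    by rewrite ltr_nat ltnS leqNgt kk'.
  apply/seteqP; split=> x //= [ux vx].
  have /orP[h1|h1] : (u i < v i)%N || (v i < u i)%N by rewrite -neq_ltn.
    exact: cell_disj h1 ux vx.
  exact: cell_disj h1 vx ux.
- apply/seteqP; split=> [x [q /= /mapP[k _ ->]]|x abx].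
    exact: grid_cell_sub.
  have /choice[k kx] i := exists_grid_index (abx i).
  exists (grid_cell [ffun i => k i]) => /=.
    by apply/mapP; exists [ffun i => k i] => //; rewrite mem_enum.
  by move=> i; rewrite in_itv/= !mxE !ffunE; exact: kx.
Qed.

End grid.

(** * Vitali variation and integration by parts *)

Lemma cst_box_integrable (R : realType) n (a b : 'rV[R]_n) (c : R) :
  (lebesgue_rV n).-integrable (box a b) (EFin \o cst c).
Proof.
apply: continuous_box_integrable; apply: continuous_subspaceT => x.
exact: cst_continuous.
Qed.

Section vitali.
Context {R : realType} {n : nat}.
Variables (a b : 'rV[R]_n) (f g : 'rV[R]_n -> R).
Hypothesis ab : forall i, a 0 i < b 0 i.
Let S := box a b.
Hypothesis Sf : Ck_upto_bdry n S f.
Hypothesis cg : {within S, continuous g}.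
Hypothesis gE : forall x, S° x -> partials (enum 'I_n) f x = g x.
Local Notation mu := (@lebesgue_rV R n).

Let mS : measurable S. Proof. exact: measurable_box. Qed.
Let ig : mu.-integrable S (EFin \o g).
Proof. exact: continuous_box_integrable. Qed.

Let igs p q : S p -> S q -> mu.-integrable (box p q) (EFin \o g).
Proof.
move=> Sp Sq; apply: integrableS ig => //; first exact: measurable_box.
exact: box_sub.
Qed.

Let mabsg : measurable_fun S (fun x => `|g x|%:E).
Proof.
apply/measurable_EFinP; apply: measurableT_comp => //.
exact: within_continuous_measurable_fun.
Qed.

Lemma abs_vertex_sum_le p q : S p -> S q -> (forall i, p 0 i <= q 0 i) ->
  (`|alt_vertex_sum f (p, q)|%:E <= \int[mu]_(x in box p q) `|g x|%:E)%E.
Proof.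
move=> Sp Sq pq; rewrite -abse_EFin -(ftc_closed_box ab Sf cg gE Sp Sq pq).
apply: le_abse_integral; first exact: measurable_box.
exact: (measurable_int _ (igs Sp Sq)).
Qed.

(** Let [s] be the sign of [g p]. Since [g] differs from [g p] by less than [e] on
the cell, [|g| <= s * g + 2 e] there, and the integral of [g] is the vertex sum. *)
Lemma abs_integral_le_vertex_sum p q (e : R) : 0 <= e -> S p -> S q ->
  (forall i, p 0 i <= q 0 i) ->
  (forall x, box p q x -> `|g p - g x| < e) ->
  (\int[mu]_(x in box p q) `|g x|%:E <=
   `|alt_vertex_sum f (p, q)|%:E + (2 * e)%:E * mu (box p q))%E.
Proof.
move=> e0 Sp Sq pq osc; pose s : R := if 0 <= g p then 1 else -1.
have mB := measurable_box p q.
have ip := igs Sp Sq.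
have ic : mu.-integrable (box p q) (EFin \o cst (2 * e)).
  exact: cst_box_integrable.
have is_ : mu.-integrable (box p q) (fun x => s%:E * (EFin \o g) x)%E.
  exact: integrableZl.
apply: (@le_trans _ _ (\int[mu]_(x in box p q) (s%:E * (g x)%:E + (2 * e)%:E))%E).
  apply: ge0_le_integral => //.
  - exact: measurable_funS mS (box_sub Sp Sq) mabsg.
  - have := measurable_int _ (integrableD mB is_ ic); exact.
  - move=> x pqx; rewrite -EFinM -EFinD lee_fin; have := osc x pqx; rewrite /s.
    rewrite ltr_norml => /andP[h1 h2].
    by case: (lerP 0 (g p)) => h3; case: (ger0P (g x)) => h4; lra.
rewrite integralD//= integral_cst// integralZl// (ftc_closed_box ab Sf cg gE Sp Sq pq).
rewrite leeD2r// -EFinM lee_fin /s.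
by case: ifP => _; rewrite ?mul1r ?mulN1r ?ler_norm// -normrN ler_norm.
Qed.

(** Every partition gives at most the integral, by the triangle inequality on each
cell. Conversely, on a grid fine enough for [g] to be nearly constant on each
cell, little is lost in that inequality. *)
Lemma vitali_variation_integral :
  vitali_variation S f = (\int[mu]_(x in S) `|g x|%:E)%E.
Proof.
apply/eqP; rewrite eq_le; apply/andP; split.
  apply: ge_ereal_sup => _ [Q pQ <-].
  rewrite -sumEFin -(box_partition_integral mS pQ mabsg)//.
  have [ltQ _ _] := pQ.
  rewrite big_seq [leRHS]big_seq; apply: lee_sum => -[p q] qQ.
  have pq i : p 0 i <= q 0 i by rewrite ltW//; exact: (ltQ (p, q)).
  have sub := box_partition_sub pQ qQ.
  apply: abs_vertex_sum_le => //.
    by apply: sub; exact: box_lower.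
  by apply: sub; exact: box_upper.
apply/lee_addgt0Pr => e e0.
have muS : (mu S < +oo)%E by exact: lebesgue_rV_box_fin.
pose v := fine (mu S); have v0 : 0 <= v by exact: fine_ge0.
(* With this oscillation the total loss [2 * e' * v] stays below [e], even
   though [v] is not known to be positive here. *)
pose e' := e / (2 * (v + 1)).
have e'0 : 0 < e' by rewrite divr_gt0// mulr_gt0// ltr_wpDl.
have [d d0 dP] := heine_box cg e'0.
have [N Nd] : exists N : nat, forall i, (b 0 i - a 0 i) / N.+1%:R < d.
  (* The sum of the side lengths dominates each of them. *)
  pose c := \sum_i (b 0 i - a 0 i).
  have c0 i : b 0 i - a 0 i <= c.
    rewrite /c (bigD1 i)//= lerDl sumr_ge0// => j _.
    by rewrite subr_ge0 ltW.
  exists (Num.truncn (c / d)) => i; rewrite ltr_pdivrMr ?ltr0n// mulrC.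
  apply: le_lt_trans (c0 i) _; rewrite -ltr_pdivrMr//.
  exact: Num.Theory.truncnS_gt.
pose Q := grid a b N.
have pQ : is_box_partition S Q by exact: grid_partition.
apply: (@le_trans _ _ ((\sum_(q <- Q) `|alt_vertex_sum f q|)%:E + e%:E)%E); last first.
  by rewrite leeD2r//; apply: ereal_sup_ubound; exists Q.
rewrite -(box_partition_integral mS pQ mabsg)//.
apply: (@le_trans _ _ (\sum_(q <- Q)
    ((`|alt_vertex_sum f q|)%:E + (2 * e')%:E * mu (box q.1 q.2)))%E).
  rewrite big_seq [leRHS]big_seq; apply: lee_sum => q qQ.
  have [ltQ _ _] := pQ.
  have pq i : q.1 0 i <= q.2 0 i by rewrite ltW//; exact: ltQ.
  have sub := box_partition_sub pQ qQ.
  have S1 : S q.1 by apply: sub; exact: box_lower.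
  have S2 : S q.2 by apply: sub; exact: box_upper.
  rewrite (surjective_pairing q).
  apply: abs_integral_le_vertex_sum => //; first exact: ltW.
  move=> x qx; apply: dP => //; first exact: sub.
  move=> i; have := qx i; rewrite in_itv/= => /andP[h1 h2].
  rewrite ler0_norm ?subr_le0// opprB; apply: le_lt_trans (Nd i).
  move/mapP : qQ h2 => [k _ ->] h2.
  by rewrite -(grid_cell_width a b k i) lerB.
rewrite big_split/= -ge0_sume_distrr// (box_partition_measure mS pQ) sumEFin leeD2l//.
rewrite -[mu S]fineK ?ge0_fin_numE// -/v -EFinM lee_fin /e'.
rewrite (_ : 2 * _ * v = e * (v / (v + 1))); last by field; rewrite gt_eqF// ltr_wpDl.
apply: ler_piMr; first exact: ltW.
by rewrite ler_pdivrMr ?mul1r ?lerDl// ltr_wpDl.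
Qed.

End vitali.

Section tail_parts.
Context {R : realType} {n : nat}.
Variables (a b : 'rV[R]_n) (f g phi : 'rV[R]_n -> R).
Hypothesis ab : forall i, a 0 i < b 0 i.
Let S := box a b.
Hypothesis Sf : Ck_upto_bdry n S f.
Hypothesis cg : {within S, continuous g}.
Hypothesis gE : forall x, S° x -> partials (enum 'I_n) f x = g x.
Local Notation mu := (@lebesgue_rV R n).
Hypothesis iphi : mu.-integrable S (EFin \o phi).
Hypothesis cphi : centered a b phi.

(** In the vertex sum of [f] over the box from [a] to [x], the vertex of a subset
[nu] has its coordinates in [nu] frozen at those of [a], and the empty subset
gives [x] itself. Against a centered [phi] the sum can thus replace [f]. *)
Lemma tail_integration_by_parts :
  (\int[mu]_(x in S) (phi x * f x)%:E =
   \int[mu]_(x in S) ((\int[mu]_(y in box x b) phi y)%R * g x)%:E)%E.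
Proof.
have mS : measurable S by exact: measurable_box.
have cf : {within S, continuous f} by case: Sf.
pose V (nu : {ffun 'I_n -> bool}) (x : 'rV[R]_n) : 'rV[R]_n :=
  \row_i (x 0 i + (nu i)%:R * (a 0 i - x 0 i)).
pose h (nu : {ffun 'I_n -> bool}) x : R := (-1) ^+ (\sum_i nu i)%N * f (V nu x).
have Sa : S a by apply: box_lower => i; exact: ltW.
have SV nu x : S x -> S (V nu x) by exact: vertex_in_box.
have mh nu : measurable_fun S (h nu).
  apply: measurable_funM => //.
  apply: (measurable_comp mS) => //.
  - by move=> _ [x Sx <-]; exact: SV.
  - exact: within_continuous_measurable_fun.
  - apply: measurable_funTS; apply/measurable_fun_rVP => i.
    under eq_fun do rewrite mxE.
    have mc := @measurable_rV_coord _ R n i.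
    apply: measurable_funD => //; apply: measurable_funM => //.
    exact: measurable_funB.
have [M M0 fM] := continuous_bounded_box cf.
have bh nu : exists M : R, forall x, box a b x -> `|h nu x| <= M.
  exists M => x Sx; rewrite normrM normrX normrN1 expr1n mul1r.
  by apply: fM; exact: SV.
have hi (nu : {ffun 'I_n -> bool}) i : nu i ->
    forall x y, agree_off i x y -> h nu x = h nu y.
  move=> nui x y xy; rewrite /h; congr (_ * f _); apply/rowP => j; rewrite !mxE.
  have [->|ji] := eqVneq j i; last by rewrite xy.
  by rewrite nui !mul1r !(addrC _ (_ - _)) !subrK.
have h0 x : h [ffun=> false] x = f x.
  rewrite /h big1 => [|i _]; last by rewrite ffunE.
  rewrite expr0 mul1r; congr f; apply/rowP => i; rewrite !mxE ffunE.
  by rewrite mul0r addr0.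
have := centered_integral_sum cphi iphi mh bh hi.
under [X in _ = X -> _]eq_integral do rewrite h0.
move=> <-; rewrite -integral_tail_duality//; last exact: continuous_box_integrable.
apply: eq_integral => x /[!inE] Sx; congr (_ * _)%:E.
have ax i : a 0 i <= x 0 i by have := Sx i; rewrite in_itv/= => /andP[].
by rewrite /Rintegral (ftc_closed_box ab Sf cg gE Sa Sx ax).
Qed.

Lemma tail_bound x : S x ->
  (`|\int[mu]_(y in box x b) phi y|%:E <=
   (2 ^- n)%:E * \int[mu]_(y in S) `|phi y|%:E)%E.
Proof.
move=> Sx; apply: le_trans (centered_tail_bound cphi iphi Sx).
rewrite -abse_EFin /Rintegral fineK//; apply: integrable_fin_num.
  exact: measurable_box.
apply: integrableS iphi; [exact: measurable_box|exact: measurable_box|].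
by move=> y /(tail_boxE y Sx)[].
Qed.

Lemma measurable_tail : measurable_fun S (fun x => (\int[mu]_(y in box x b) phi y)%R).
Proof.
have i1 : mu.-integrable S (EFin \o (cst 1 : 'rV[R]_n -> R)).
  exact: cst_box_integrable.
have := measurable_tail_mul iphi i1; apply: eq_measurable_fun => x _.
by rewrite mulr1.
Qed.

End tail_parts.

(** An essentially bounded function on a set of finite measure. The box has positive
measure, so the supremum norm is the essential supremum and not the value 0 that
it takes for the zero measure. *)
Lemma LfunS_integrable (R : realType) n (a b : 'rV[R]_n) (phi : 'rV[R]_n -> R) :
  (forall i, a 0 i < b 0 i) -> LfunS (box a b) +oo%E phi ->
  (lebesgue_rV n).-integrable (box a b) (EFin \o phi).
Proof.
move=> ab /andP[]; rewrite !inE /= => mphi; rewrite /finite_norm unlock.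
have mS := measurable_box a b.
have mu0 : (0 < lebesgue_rV n [set: 'rV[R]_n])%E.
  apply: (@lt_le_trans _ _ (lebesgue_rV n (box a b))); last first.
    by apply: le_measure; rewrite ?inE.
  rewrite lebesgue_rV_box => [|i]; last exact: ltW.
  by rewrite lte_fin prodr_gt0// => i _; rewrite subr_gt0.
rewrite ifT// => supoo.
have [r supr] : exists r : R, (ess_sup (lebesgue_rV n)
    (abse \o (EFin \o (phi \_ (box a b)))) <= r%:E)%E.
  case: (ess_sup _ _) supoo => [r _|//|_]; first by exists r.
  by exists 0; exact: leNye.
have mphiS : measurable_fun (box a b) phi.
  by rewrite -(setTI (box a b)); apply/(measurable_restrict _ mS measurableT).
apply/integrableP; split; first exact/measurable_EFinP.
apply: (@le_lt_trans _ _ (\int[lebesgue_rV n]_(x in box a b) (cst `|r|%:E) x)%E).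
  apply: ae_ge0_le_integral => //.
    by apply: measurableT_comp => //; exact/measurable_EFinP.
    by move=> x _; rewrite lee_fin.
  move/ess_supP : supr; apply: filterS => x /= + Sx.
  rewrite patchE mem_set// => /le_trans; apply.
  by rewrite lee_fin ler_norm.
rewrite integral_cst// lte_mul_pinfty//.
exact: lebesgue_rV_box_fin.
Qed.

(** * The theorem *)

Theorem corollary2p13 (R : realType) (d : nat) (a b : 'rV[R]_d)
    (f phi : 'rV[R]_d -> R) :
  (0 < d)%N ->
  (forall i, a 0 i < b 0 i) ->
  let S := box a b in
  let mu := lebesgue_rV d in
  Ck_upto_bdry d S f ->
  LfunS S +oo%E phi ->
  centered a b phi ->
  [/\ LfunS S +oo%E (tail_int b phi) /\
      (LnormS S +oo (tail_int b phi) <= (2 ^- d)%:E * LnormS S 1 phi)%E,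
      (\int[mu]_(x in S) (phi x * f x)%:E =
       \int[mu]_(x in S) (tail_int b phi x * mixed_partial S f x)%:E)%E,
      (`|\int[mu]_(x in S) (phi x * f x)%:E| <=
       (2 ^- d)%:E * LnormS S 1 phi *
       \int[mu]_(x in S) `|mixed_partial S f x|%:E)%E,
      (vitali_variation S f =
       \int[mu]_(x in S) `|mixed_partial S f x|%:E)%E &
      (`|\int[mu]_(x in S) (phi x * f x)%:E| <=
       (2 ^- d)%:E * LnormS S 1 phi * vitali_variation S f)%E].
Proof.
move=> _ ab S mu Sf Lphi cphi.
have mS : measurable S by exact: measurable_box.
have [_ /(_ (enum 'I_d))] := Sf; rewrite -cardE card_ord => /(_ (leqnn d))[_ [g cg gE]].
have iphi : mu.-integrable S (EFin \o phi) by exact: LfunS_integrable.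
have mixE x : S x -> mixed_partial S f x = g x by exact: mixed_partialE.
have tailE x : S x -> tail_int b phi x = (\int[mu]_(y in box x b) phi y).
  move=> Sx; apply: tail_int_box; apply: integrableS iphi => //.
    exact: measurable_box.
  by move=> y /(tail_boxE y Sx)[].
have norm1 : LnormS S 1 phi = (\int[mu]_(x in S) `|phi x|%:E)%E.
  rewrite /LnormS Lnorm1 [RHS]integral_mkcond; apply: eq_integral => x _.
  by rewrite /= !patchE; case: ifP => //= _; rewrite normr0.
have norm1_ge0 : (0 <= LnormS S 1 phi)%E by exact: Lnorm_ge0.
have norm1_fin : LnormS S 1 phi \is a fin_num.
  by rewrite norm1; apply: integrable_fin_num => //; exact: integrable_abse iphi.
have c0 : 0 <= 2 ^- d :> R by rewrite invr_ge0 exprn_ge0.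
have C0 : (0 <= (2 ^- d)%:E * LnormS S 1 phi)%E by rewrite mule_ge0.
have bnd x : S x -> (`|tail_int b phi x|%:E <= (2 ^- d)%:E * LnormS S 1 phi)%E.
  by move=> Sx; rewrite norm1 tailE//; exact: tail_bound.
have absE : (\int[mu]_(x in S) `|mixed_partial S f x|%:E =
    \int[mu]_(x in S) `|g x|%:E)%E.
  by apply: eq_integral => x /[!inE] Sx; rewrite mixE.
have mtail : measurable_fun S (tail_int b phi).
  apply: eq_measurable_fun (measurable_tail iphi) => x /[!inE] Sx.
  by rewrite tailE.
have mg : measurable_fun S g by exact: within_continuous_measurable_fun.
have normy : (LnormS S +oo (tail_int b phi) <= (2 ^- d)%:E * LnormS S 1 phi)%E.
  rewrite {1}/LnormS unlock; case: ifP => // _; apply/ess_supP.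
  apply: aeW => x /=; rewrite patchE; case: ifPn => [/[!inE]|_]; first exact: bnd.
  by rewrite normr0.
have vit := vitali_variation_integral ab Sf cg gE.
have parts : (\int[mu]_(x in S) (phi x * f x)%:E =
    \int[mu]_(x in S) (tail_int b phi x * g x)%:E)%E.
  rewrite (tail_integration_by_parts ab Sf cg gE iphi cphi).
  by apply: eq_integral => x /[!inE] Sx; rewrite tailE.
have est : (`|\int[mu]_(x in S) (phi x * f x)%:E| <=
    (2 ^- d)%:E * LnormS S 1 phi * \int[mu]_(x in S) `|g x|%:E)%E.
  rewrite parts; apply: le_trans (le_abse_integral _ _ _) _ => //.
    by apply/measurable_EFinP; exact: measurable_funM.
  rewrite -ge0_integralZl//; last first.
    by apply/measurable_EFinP; exact: measurableT_comp.
  apply: ge0_le_integral => //.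
  - by apply: measurableT_comp => //; apply/measurable_EFinP; exact: measurable_funM.
  - by apply: emeasurable_funM => //; apply/measurable_EFinP; exact: measurableT_comp.
  - by move=> x Sx; rewrite /= normrM EFinM; apply: lee_wpmul2r => //; exact: bnd.
split.
- split=> //; rewrite /LfunS; apply/andP; split; rewrite inE /=.
    by apply/(measurable_restrict _ mS measurableT); rewrite setTI.
  apply: le_lt_trans normy _; rewrite ltey_eq; apply/orP; left.
  by rewrite fin_numM.
- by rewrite parts; apply: eq_integral => x /[!inE] Sx; rewrite mixE.
- by rewrite absE.
- by rewrite absE.
- by rewrite vit.
Qed.
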